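(* Assume the Continuum Hypothesis. For every field $K$ of cardinality $\aleph_1$ and every stationary subset $S\subseteq\omega_1$, there is a valuation domain $R$ of cardinality $\aleph_1$ with residue field $K$ and quotient field $Q$, with $Q=\bigcup_{\nu<\omega_1}r_\nu^{-1}R$ for some $r_\nu\in R\setminus\{0\}$ with $r_\mu\mid r_\nu$ for $\mu<\nu$, such that $\Gamma_R(Q/R)=\tilde S$ and there is a non-standard uniserial $R$-module of type $Q/R$.
   Context: Residue field of a valuation domain $R$: $R/P$ with $P$ the maximal ideal. Uniserial: submodules totally ordered. For $R$-submodules $A\subseteq J$ of $Q$, $J/A$ is uniserial; a uniserial module is standard if isomorphic to such a $J/A$, non-standard otherwise. For uniserial $U$ and $0\ne a\in U$, $\mathrm{Ann}(a)=\{r:ra=0\}$, $D(a)=\bigcup\{r^{-1}R: r\text{ divides }a\}$; $U$ has type $Q/R$ if $Q/R\cong D(a)/\mathrm{Ann}(a)$. For $J=\bigcup_{\nu<\omega_1}r_\nu^{-1}R$ and limit $\delta<\omega_1$, $(A:J_\delta)=\bigcap_{\nu<\delta}r_\nu A$ and $R/(A:J_\delta)$ has the linear topology with basic neighborhoods of $0$ the images of $r_\nu A$, $\nu<\delta$. Subsets of $\omega_1$ are equivalent if they agree on a closed unbounded set; $\tilde S$ denotes the class of $S$. $\Gamma_R(J/A)=\tilde S'$ with $S'=\{\delta<\omega_1\text{ limit}: R/(A:J_\delta)\text{ not complete}\}$ (independent of the choice of $r_\nu$). A set $S\subseteq\omega_1$ is stationary if it meets every closed unbounded subset of $\omega_1$.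 *)

(* Defs.v *)
From HB Require Import structures.
From mathcomp Require Import all_boot all_order all_algebra.
From mathcomp Require Import fraction.
Set Implicit Arguments. Unset Strict Implicit. Unset Printing Implicit Defensive.
Import Order.TTheory GRing.Theory Num.Theory.
Local Open Scope ring_scope.

Notation "x %:F" := (@FracField.tofrac _ x) : ring_scope.

(* omega_1, modelled as a type W with a strict order lt that is a     *)
(* well-order whose proper initial segments are countable while W is  *)
(* uncountable (this characterises omega_1 up to order isomorphism).  *)
Section Omega1.
Variables (W : Type) (lt : W -> W -> Prop).

Definition countable_pred (P : W -> Prop) : Prop :=
  exists f : W -> nat, forall x y, P x -> P y -> f x = f y -> x = y.

Definition is_omega1 : Prop :=
  (forall x, ~ lt x x) /\
  (forall x y z, lt x y -> lt y z -> lt x z) /\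
  (forall x y, lt x y \/ x = y \/ lt y x) /\
  well_founded lt /\
  ~ countable_pred (fun _ => True) /\
  (forall x, countable_pred (fun y => lt y x)).

Definition le (x y : W) : Prop := lt x y \/ x = y.

Definition is_limit (d : W) : Prop :=
  (exists m, lt m d) /\ (forall m, lt m d -> exists n, lt m n /\ lt n d).

Definition unbounded (C : W -> Prop) : Prop :=
  forall x, exists y, C y /\ le x y.

Definition closed (C : W -> Prop) : Prop :=
  forall d, is_limit d ->
    (forall m, lt m d -> exists c, C c /\ le m c /\ lt c d) -> C d.

Definition club (C : W -> Prop) : Prop := closed C /\ unbounded C.

Definition stationary (S : W -> Prop) : Prop :=
  forall C, club C -> exists x, C x /\ S x.

Definition club_equiv (S S' : W -> Prop) : Prop :=
  exists C, club C /\ forall x, C x -> (S x <-> S' x).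

End Omega1.

Definition equipotent (A B : Type) : Prop := exists f : A -> B, bijective f.

Definition dvdR (R : idomainType) (a b : R) : Prop := exists c, b = c * a.

Definition valuation_domain (R : idomainType) : Prop :=
  forall a b : R, dvdR a b \/ dvdR b a.

(* The residue field R/P (P = maximal ideal = set of non-units of the *)
(* local ring R) is isomorphic to K: there is a surjective ring        *)
(* morphism R -> K with kernel P.                                      *)
Definition residue_field_is (R : idomainType) (K : fieldType) : Prop :=
  exists phi : {rmorphism R -> K},
    (forall k : K, exists x, phi x = k) /\
    (forall x : R, phi x = 0 <-> ~~ (x \is a GRing.unit)).

Definition inR (R : idomainType) (q : {fraction R}) : Prop :=
  exists s : R, q = s%:F.

Definition submodQ (R : idomainType) (P : {fraction R} -> Prop) : Prop :=
  [/\ P 0,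
      (forall x y, P x -> P y -> P (x + y))
    & (forall (r : R) x, P x -> P (r%:F * x))].

(* J/A ~= J'/A' (A <= J, A' <= J' submodules of Q): written out with a  *)
(* lifting f : J -> J' of the isomorphism to representatives.           *)
Definition quot_iso (R : idomainType) (J A J' A' : {fraction R} -> Prop)
  : Prop :=
  exists f : {fraction R} -> {fraction R},
    [/\ (forall x, J x -> J' (f x)),
        (forall (r : R) x y, J x -> J y ->
            A' (f (r%:F * x + y) - (r%:F * f x + f y))),
        (forall x, J x -> (A' (f x) <-> A x))
      & (forall y, J' y -> exists x, J x /\ A' (f x - y))].

Section Uniserial.
Variables (R : idomainType) (M : lmodType R).

Definition submod (P : M -> Prop) : Prop :=
  [/\ P 0,
      (forall x y, P x -> P y -> P (x + y))
    & (forall (r : R) x, P x -> P (r *: x))].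

Definition uniserial : Prop :=
  forall P1 P2, submod P1 -> submod P2 ->
    (forall x, P1 x -> P2 x) \/ (forall x, P2 x -> P1 x).

(* M ~= J/A for R-submodules A <= J of Q *)
Definition standard : Prop :=
  exists (A J : {fraction R} -> Prop),
    [/\ submodQ A, submodQ J, (forall x, A x -> J x) &
      exists f : {fraction R} -> M,
        [/\ (forall (r : R) x y, J x -> J y ->
               f (r%:F * x + y) = r *: f x + f y),
            (forall x, J x -> (f x = 0 <-> A x))
          & (forall u : M, exists x, J x /\ f x = u)]].

Definition nonstandard_uniserial : Prop := uniserial /\ ~ standard.

Definition AnnQ (a : M) : {fraction R} -> Prop :=
  fun q => exists r : R, q = r%:F /\ r *: a = 0.

Definition DQ (a : M) : {fraction R} -> Prop :=
  fun q => exists r : R, r != 0 /\ (exists b : M, r *: b = a) /\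
             exists s : R, q = s%:F / r%:F.

Definition has_type_QR : Prop :=
  exists a : M, a != 0 /\
    quot_iso (fun _ => True) (@inR R) (DQ a) (AnnQ a).

End Uniserial.

Section Gamma.
Variables (W : Type) (lt : W -> W -> Prop) (R : idomainType) (r : W -> R).

(* R/(R : Q_d), with (R : Q_d) = \bigcap_{nu<d} r_nu R, is complete in   *)
(* the linear topology with basic neighbourhoods the images of r_nu R:   *)
(* every compatible (Cauchy) family indexed by nu < d has a limit.       *)
Definition complete_at (d : W) : Prop :=
  forall x : W -> R,
    (forall m n, lt m n -> lt n d -> dvdR (r m) (x m - x n)) ->
    exists y : R, forall n, lt n d -> dvdR (r n) (y - x n).

Definition GammaQR_set : W -> Prop :=
  fun d => is_limit lt d /\ ~ complete_at d.

End Gamma.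

(* Main.v *)
(* Let R consist of the Hahn series over K, with nonnegative exponents in the group of
   finitely supported functions from omega_1 to Z ordered antilexicographically, whose
   variables are bounded and which, for every limit D in S, have only coefficients with
   variables bounded below D when viewed as series in the variables X_t with t >= D. This
   is a valuation domain with residue field K. With r_n = X_n, a Cauchy sequence at a
   limit D outside S has its formal limit in R, while for D in S the sum of the X_t over
   a cofinal omega-sequence of t < D is missing.
   Choose functions f_n from n to K that are finite-to-one and coherent modulo finite
   sets. The finite products e_n^m of (1 + f_n(t) X_t) / (1 + f_m(t) X_t) over t < n
   satisfy e_n^p = e_n^m e_m^p modulo r_n, hence define a direct limit of the R / r_n R,
   which is uniserial of type Q/R. If it were standard, there would be units c_n with
   c_n = e_n^m c_m modulo r_n. For n in S the variables of c_n below n are bounded by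
   some h(n) < n; by Fodor's lemma h(n) = a for unboundedly many n in S, and comparing
   the coefficients of X_t for a < t < n shows f_n(t) = f_m(t) for these n < m. So the
   f_n glue above a to a function on omega_1 that is finite-to-one on every initial
   segment, but has countable range: a contradiction. *)
Require Import Defs.
From HB Require Import structures.
From mathcomp Require Import all_boot all_order all_algebra.
From mathcomp Require Import fraction finmap.
From mathcomp Require Import boolp classical_sets functions cardinality fsbigop.
From mathcomp Require Import ring.
Set Implicit Arguments. Unset Strict Implicit. Unset Printing Implicit Defensive.
Import Order.TTheory GRing.Theory Num.Theory.
Local Open Scope classical_set_scope.
Local Open Scope ring_scope.
Local Open Scope order_scope.

(** * Antilexicographically ordered exponents *)

Lemma finite_max d (T : orderType d) (A : set T) :
  finite_set A -> A !=set0 -> exists2 m, A m & forall t, A t -> t <= m.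
Proof.
move=> /finite_seqP[s ->] {A}; elim: s => [[x]//|x s IH] _.
have [[y ys]|/set0P/negP/negPn/eqP s0] := pselect ([set` s] !=set0).
  have [m ms mmax] := IH (ex_intro _ _ ys).
  have [xm|mx] := leP x m.
    by exists m => [|t]; rewrite /= inE ?ms ?orbT// => /orP[/eqP->//|/mmax].
  exists x => [|t]; rewrite /= inE ?eqxx// => /orP[/eqP->//|/mmax tm].
  exact: le_trans tm (ltW mx).
exists x => [|t]; rewrite /= inE ?eqxx// => /orP[/eqP->//|ts].
by have : [set` s] t by []; rewrite s0.
Qed.

Section Expo.
Context {d : Order.disp_t} {W : orderType d}.
Implicit Types (t s : W) (o : option W).

Record expo := Expo { ef :> W -> int; efP : finite_set [set t | ef t != 0] }.

HB.instance Definition _ := gen_eqMixin expo.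
HB.instance Definition _ := gen_choiceMixin expo.

Lemma expoP (g h : expo) : (forall t, g t = h t) -> g = h.
Proof.
case: g h => [g gP] [h hP] /= gh; have E : g = h by apply/funext.
by case: _ / E hP {gh} => hP; congr Expo; exact: Prop_irrelevance.
Qed.

Fact expo0_subproof : finite_set [set t : W | (0 : int) != 0].
Proof. by rewrite (_ : [set _ | _] = set0)//; apply/seteqP; split=> t //. Qed.
Definition expo0 : expo := Expo expo0_subproof.

Fact expoN_subproof (g : expo) : finite_set [set t | - g t != 0].
Proof. by apply: sub_finite_set (efP g) => t; rewrite /= oppr_eq0. Qed.
Definition expoN g : expo := Expo (expoN_subproof g).

Fact expoD_subproof (g h : expo) : finite_set [set t | g t + h t != 0].
Proof.
apply: (@sub_finite_set _ _ ([set t | g t != 0] `|` [set t | h t != 0])).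
  move=> t /=; have [->|] := eqVneq (g t) 0; last by left.
  by rewrite add0r; right.
by rewrite finite_setU; split; exact: efP.
Qed.
Definition expoD g h : expo := Expo (expoD_subproof g h).

Fact expo_addA : associative expoD. Proof. by move=> *; apply: expoP => t /=; rewrite addrA. Qed.
Fact expo_addC : commutative expoD. Proof. by move=> *; apply: expoP => t /=; rewrite addrC. Qed.
Fact expo_add0 : left_id expo0 expoD. Proof. by move=> *; apply: expoP => t /=; rewrite add0r. Qed.
Fact expo_addN : left_inverse expo0 expoN expoD.
Proof. by move=> *; apply: expoP => t /=; rewrite addNr. Qed.
HB.instance Definition _ := GRing.isZmodule.Build expo expo_addA expo_addC expo_add0 expo_addN.

Lemma expoDE (g h : expo) t : (g + h) t = g t + h t. Proof. by []. Qed.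
Lemma expoNE (g : expo) t : (- g) t = - g t. Proof. by []. Qed.
Lemma expo0E t : (0 : expo) t = 0. Proof. by []. Qed.

Lemma expo_top (g h : expo) : g <> h ->
  exists2 t, g t != h t & forall s, t < s -> g s = h s.
Proof.
move=> gh; have fin : finite_set [set t | (g - h) t != 0] by exact: efP.
have [|t gt tmax] := finite_max fin.
  apply/set0P; apply/eqP => E; apply: gh; apply: expoP => t.
  apply/eqP; rewrite -subr_eq0; apply/negPn/negP => nz.
  by have : [set t | (g - h) t != 0] t by []; rewrite E.
exists t; first by rewrite -subr_eq0.
move=> s ts; apply/eqP; rewrite -subr_eq0; apply/negPn/negP => nz.
by have := tmax s nz; rewrite leNgt ts.
Qed.

Definition expo_lt (g h : expo) : bool :=
  `[< exists2 t, g t < h t & forall s, t < s -> g s = h s >].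

Fact expo_ltxx : irreflexive expo_lt.
Proof. by move=> g; apply/asboolP => -[t]; rewrite ltxx. Qed.

Fact expo_lt_trans : transitive expo_lt.
Proof.
move=> h g k /asboolP[t gh Egh] /asboolP[s hk Ehk]; apply/asboolP.
have [ts|st|E] := ltgtP t s.
- exists s => [|u su]; first by rewrite Egh.
  by rewrite Egh ?Ehk// (lt_trans ts).
- exists t => [|u tu]; first by rewrite -Ehk.
  by rewrite Egh ?Ehk// (lt_trans st).
- by rewrite E in gh Egh; exists s => [|u su]; [exact: lt_trans hk|rewrite Egh ?Ehk].
Qed.

HB.instance Definition _ := Order.Lt_isPOrder.Build ring_display expo expo_ltxx expo_lt_trans.

Fact expo_total : total (<=%O : rel expo).
Proof.
move=> g h; have [->|/eqP /expo_top[t]] := eqVneq g h; first by rewrite lexx.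
rewrite neq_lt => /orP[] lt Es.
  by rewrite ltW//; apply/asboolP; exists t.
rewrite [X in _ || X]ltW ?orbT//; apply/asboolP; exists t => // s ts.
by rewrite Es.
Qed.
HB.instance Definition _ := Order.POrder_isTotal.Build ring_display expo expo_total.

Lemma expo_ltP (g h : expo) :
  reflect (exists2 t, g t < h t & forall s, t < s -> g s = h s) (g < h).
Proof. exact: asboolP. Qed.

Lemma ltD2l (g h k : expo) : (g + h < g + k) = (h < k).
Proof.
apply/expo_ltP/expo_ltP => -[t lt E]; exists t => [|s ts].
- by rewrite !expoDE ltrD2l in lt.
- by have := E s ts; rewrite !expoDE => /addrI.
- by rewrite !expoDE ltrD2l.
- by rewrite !expoDE E.
Qed.

Lemma ltD2r (g h k : expo) : (h + g < k + g) = (h < k).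
Proof. by rewrite ![_ + g]addrC ltD2l. Qed.
Lemma leD2l (g h k : expo) : (g + h <= g + k) = (h <= k).
Proof. by rewrite !leNgt ltD2l. Qed.
Lemma leD2r (g h k : expo) : (h + g <= k + g) = (h <= k).
Proof. by rewrite !leNgt ltD2r. Qed.
Lemma ltBl_gt0 (g h : expo) : (g - h < g) = (0 < h).
Proof. by rewrite -[X in _ < X]addr0 ltD2l -(ltD2l h) subrr addr0. Qed.
Lemma leBl_ge0 (g h : expo) : (g - h <= g) = (0 <= h).
Proof. by rewrite -[X in _ <= X]addr0 leD2l -(leD2l h) subrr addr0. Qed.
Lemma leBr0 (g h : expo) : (0 <= g - h) = (h <= g).
Proof. by rewrite -(leD2r h 0) add0r subrK. Qed.
Lemma expo_addr_ge0 (g h : expo) : 0 <= g -> 0 <= h -> 0 <= g + h.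
Proof. by move=> g0 h0; apply: le_trans g0 _; rewrite -{1}[g]addr0 leD2l. Qed.

Fact eX_subproof t : finite_set [set s | ((s == t)%:R : int) != 0].
Proof. by apply: sub_finite_set (finite_set1 t) => s /=; case: (s =P t). Qed.
Definition eX t : expo := Expo (eX_subproof t).

Lemma eXE t s : eX t s = (s == t)%:R. Proof. by []. Qed.

Lemma eX_gt0 t : 0 < eX t.
Proof.
apply/expo_ltP; exists t => [|s ts]; rewrite ?eXE ?eqxx//.
by rewrite (gt_eqF ts).
Qed.

Lemma eX_lt t s : t < s -> eX t < eX s.
Proof.
move=> ts; apply/expo_ltP; exists s => [|u su]; rewrite !eXE.
  by rewrite eqxx (gt_eqF ts).
by rewrite !gt_eqF// (lt_trans ts).
Qed.

Lemma eX_inj : injective eX.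
Proof.
by move=> t s /(congr1 (fun g : expo => g t)); rewrite !eXE eqxx; case: eqP.
Qed.

(* [None] stands for the whole index set, [Some u] for its proper initial segment
   below [u]. *)
Definition below o t : bool := if o is Some u then t < u else true.

Lemma below_le o t s : s <= t -> below o t -> below o s.
Proof. by case: o => //= u st /(le_lt_trans st). Qed.

Definition eqout o (g h : expo) : Prop := forall t, ~~ below o t -> g t = h t.
Definition eqabove u (g h : expo) : Prop := forall t, u < t -> g t = h t.

Fact proj_subproof o (g : expo) :
  finite_set [set t | (if below o t then 0 else g t) != 0].
Proof. by apply: sub_finite_set (efP g) => t /=; case: below; rewrite ?eqxx. Qed.
(** Forgetting the variables of [o]: exponents with the same projection belong to the same
    coefficient of a series in the variables outside [o]. *)
Definition proj o g : expo := Expo (proj_subproof o g).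

Lemma projP o (g h : expo) : proj o g = proj o h <-> eqout o g h.
Proof.
split=> [E t /negPf bt|E].
  by have := congr1 (fun g : expo => g t) E; rewrite /= bt.
by apply: expoP => t /=; case: ifPn => // /E.
Qed.

Lemma projD o (g h : expo) : proj o (g + h) = proj o g + proj o h.
Proof. by apply: expoP => t; rewrite [RHS]expoDE /=; case: below; rewrite ?addr0. Qed.

Lemma projN o (g : expo) : proj o (- g) = - proj o g.
Proof. by apply: expoP => t; rewrite [RHS]expoNE /=; case: below; rewrite ?oppr0. Qed.

Lemma proj0 o : proj o 0 = 0.
Proof. by apply: expoP => t; rewrite /=; case: below. Qed.

Lemma proj_idem o (g : expo) : proj o (proj o g) = proj o g.
Proof. by apply: expoP => t; rewrite /=; case: below. Qed.

(** The variables of [o] are the smallest ones, so the top index at which the projections differ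
    also decides the order of [g] and [h]. *)
Lemma proj_lt o (g h : expo) : proj o g < proj o h -> g < h.
Proof.
move=> /expo_ltP[t /=]; case: ifPn => // nbt lt E; apply/expo_ltP; exists t => // s ts.
have := E s ts => /=; case: ifPn => // bs.
by have := below_le (ltW ts) bs; rewrite (negPf nbt).
Qed.

Lemma proj_le o (g h : expo) : g <= h -> proj o g <= proj o h.
Proof. by rewrite !leNgt; apply: contra; exact: proj_lt. Qed.


Lemma eqabove_le u v g h : u <= v -> eqabove u g h -> eqabove v g h.
Proof. by move=> uv E t vt; apply: E; exact: le_lt_trans vt. Qed.

(** The top index at which [g] and [h] differ lies in [o] and serves as the bound; [u0] is used when
    they are equal. *)
Lemma eqout_eqabove o u0 (g h : expo) : below o u0 -> eqout o g h ->
  exists2 u, below o u & eqabove u g h.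
Proof.
move=> u0o gh; have [->|/eqP /expo_top[t /eqP nt E]] := eqVneq g h; first by exists u0.
by exists t => //; apply: contrapT => /negP /gh.
Qed.
End Expo.
Arguments expo {d} W.

(** * Well-ordered supports and convolution *)

Definition wo d (T : orderType d) (D : set T) : Prop := forall P : set T,
  P `<=` D -> P !=set0 -> exists2 m, P m & forall x, P x -> m <= x.

Section WellOrdered.
Context {d : Order.disp_t} {T : orderType d}.
Implicit Types (D E : set T).

Lemma wo_sub D E : D `<=` E -> wo E -> wo D.
Proof. by move=> DE woE P PD; apply: woE => x /PD /DE. Qed.

Lemma woU D E : wo D -> wo E -> wo (D `|` E).
Proof.
move=> woD woE P PDE [p Pp].
have [[a aPD]|nD] := pselect ((P `&` D) !=set0); last first.
  by apply: woE => [x Px|]; [have [Dx|//] := PDE x Px; case: nD; exists x|exists p].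
have [a0 [Pa0 Da0] a0min] := woD (P `&` D) (@subIsetr _ _ _) (ex_intro _ a aPD).
have [[b bPE]|nE] := pselect ((P `&` E) !=set0); last first.
  exists a0 => // x Px; apply: a0min; split=> //.
  by have [//|Ex] := PDE x Px; case: nE; exists x.
have [b0 [Pb0 Eb0] b0min] := woE (P `&` E) (@subIsetr _ _ _) (ex_intro _ b bPE).
have [ab|ba] := leP a0 b0.
  exists a0 => // x Px; have [Dx|Ex] := PDE x Px; first exact: a0min.
  by apply: le_trans ab _; exact: b0min.
exists b0 => // x Px; have [Dx|Ex] := PDE x Px; last exact: b0min.
by apply: le_trans (ltW ba) _; exact: a0min.
Qed.

Lemma wo_set1 (a : T) : wo [set a].
Proof. by move=> P Pa [p Pp]; exists p => // x /Pa ->; rewrite (Pa p). Qed.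

Lemma wo_finite D : finite_set D -> wo D.
Proof.
move=> /finite_seqP[s ->]; elim: s => [|a s IH].
  by move=> P PD [p /PD].
have -> : [set` a :: s] = [set a] `|` [set` s].
  apply/seteqP; split=> x /=; rewrite inE; first by move=> /orP[/eqP|]; [left|right].
  by move=> [->|->]; rewrite ?eqxx ?orbT.
exact: woU (@wo_set1 a) IH.
Qed.

Lemma wo_ind D : wo D -> forall Q : T -> Prop,
  (forall a, D a -> (forall b, D b -> b < a -> Q b) -> Q a) -> forall a, D a -> Q a.
Proof.
move=> woD Q IH a Da; apply: contrapT => nQa.
have [|m [Dm nQm] mmin] := woD [set b | D b /\ ~ Q b] (fun _ => @proj1 _ _).
  by exists a.
apply: nQm; apply: IH => // b Db bm; apply: contrapT => nQb.
by have := mmin b (conj Db nQb); rewrite leNgt bm.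
Qed.

(** By induction along [D] each segment up to [a] is finite, since the elements less than [a], if
    any, have a maximum. The segment up to the maximum of [D] is all of [D]. *)
Lemma wo_rev_finite D : wo D ->
  (forall P, P `<=` D -> P !=set0 -> exists2 m, P m & forall x, P x -> x <= m) ->
  finite_set D.
Proof.
move=> woD rwo; apply: contrapT => Dinf.
have key a : D a -> finite_set (D `&` [set b | b <= a]).
  move: a; apply: (wo_ind woD) => a Da IH.
  have [E|/set0P ne] := eqVneq (D `&` [set b | b < a]) set0.
    apply: sub_finite_set (finite_set1 a) => b [Db /=].
    rewrite le_eqVlt => /orP[/eqP->//|ba].
    by have : (D `&` [set b | b < a]) b by []; rewrite E.
  have [m [Dm ma] mmax] := rwo _ (@subIsetl _ _ _) ne.
  apply: (@sub_finite_set _ _ ((D `&` [set b | b <= m]) `|` [set a])).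
    move=> b [Db /=]; rewrite le_eqVlt => /orP[/eqP->|ba]; first by right.
    by left; split=> //; exact: mmax.
  by rewrite finite_setU; split; [exact: IH|exact: finite_set1].
have [E|/set0P ne] := eqVneq D set0; first by apply: Dinf; rewrite E; exact: finite_set0.
have [m Dm mmax] := rwo D (@subset_refl _ _) ne.
by apply: Dinf; apply: sub_finite_set (key m Dm) => b Db; split=> //; exact: mmax.
Qed.
End WellOrdered.

Lemma wo_image d (T : orderType d) d' (U : orderType d') (f : T -> U) (D : set T) :
  (forall a b, a <= b -> f a <= f b) -> wo D -> wo (f @` D).
Proof.
move=> fmono woD P PD [p Pp].
have [|m [Dm Pm] mmin] := woD (D `&` f @^-1` P) (@subIsetl _ _ _).
  by have [a Da ap] := PD p Pp; exists a; split=> //=; rewrite ap.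
exists (f m) => // x Px; have [a Da ax] := PD x Px.
by rewrite -ax; apply: fmono; apply: mmin; split=> //=; rewrite ax.
Qed.

Section ExpoSets.
Context {d : Order.disp_t} {W : orderType d}.
Implicit Types (D E : set (expo W)) (g : expo W).

(** The map from [a] to [g - a] reverses the order, so minima in [E] become maxima in this subset of
    [D]. *)
Lemma wo_pairs_finite D E g : wo D -> wo E -> finite_set [set a | D a /\ E (g - a)].
Proof.
move=> woD woE; apply: wo_rev_finite.
  by apply: wo_sub woD => a [].
move=> P PD [p Pp].
have [||m Pm mmin] := woE ((fun a => g - a) @` P).
- by move=> _ [a Pa <-]; case: (PD a Pa).
- by exists (g - p); exists p.
have [a Pa am] := Pm; exists a => // b Pb.
have := mmin (g - b) (ex_intro2 _ _ b Pb erefl).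
by rewrite -am leD2l -(leD2l (a + b)) addrK [a + b]addrC addrK.
Qed.

(** Let [b0] be the least second summand occurring in [P], with [a1 + b0] in [P]. Whatever lies in
    [P] below [a1 + b0] has a first summand less than [a1], which allows an induction along [D]. *)
Lemma wo_sumset D E : wo D -> wo E -> wo [set a + b | a in D & b in E].
Proof.
move=> woD woE.
pose Q (A : set (expo W)) (P : set (expo W)) :=
  forall p, P p -> exists a b, [/\ D a, A a, E b & p = a + b].
have step (A P : set (expo W)) : Q A P -> P !=set0 ->
    exists a1 b0, [/\ D a1, A a1, P (a1 + b0) &
      forall p, P p -> p < a1 + b0 -> exists a b, [/\ D a, a < a1, E b & p = a + b]].
  move=> QAP [p Pp].
  have [||b0 [Eb0 [a1 [Da1 Aa1 P1]]] b0min] :=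
    woE [set b | E b /\ exists a, [/\ D a, A a & P (a + b)]].
  - by move=> b [].
  - have [a [b [Da Aa Eb pab]]] := QAP p Pp.
    by exists b; split=> //; exists a; rewrite -pab.
  exists a1, b0; split=> // q Pq qlt.
  have [a [b [Da Aa Eb qab]]] := QAP q Pq.
  exists a, b; split=> //; rewrite ltNge; apply/negP => aa1.
  have b0b : b0 <= b by apply: b0min; split=> //; exists a; rewrite -qab.
  move: qlt; rewrite qab ltNge => /negP; apply.
  by apply: (@le_trans _ _ (a + b0)); rewrite ?leD2l ?leD2r.
have lem : forall c, D c -> forall P, Q [set a | a < c] P -> P !=set0 ->
    exists2 m, P m & forall x, P x -> m <= x.
  apply: (wo_ind woD) => c Dc IH P QP P0.
  have [a1 [b0 [Da1 a1c P1 low]]] := step _ _ QP P0.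
  have [[p [Pp plt]]|no] := pselect ((P `&` [set p | p < a1 + b0]) !=set0).
    have [|m [Pm mlt] mmin] := IH a1 Da1 a1c (P `&` [set p | p < a1 + b0]) _
        (ex_intro _ p (conj Pp plt)).
      by move=> q [Pq qlt]; have [a [b []]] := low q Pq qlt; exists a, b.
    exists m => // x Px; have [xlt|/(lt_le_trans mlt)/ltW//] := ltP x (a1 + b0).
    exact: mmin.
  exists (a1 + b0) => // x Px; rewrite leNgt; apply/negP => xlt.
  by apply: no; exists x.
move=> P PDE P0.
have QP : Q setT P.
  by move=> p /PDE[a Da [b Eb <-]]; exists a, b.
have [a1 [b0 [Da1 _ P1 low]]] := step _ _ QP P0.
have [[p [Pp plt]]|no] := pselect ((P `&` [set p | p < a1 + b0]) !=set0).
  have [|m [Pm mlt] mmin] := lem a1 Da1 (P `&` [set p | p < a1 + b0]) _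
      (ex_intro _ p (conj Pp plt)).
    by move=> q [Pq qlt]; have [a [b []]] := low q Pq qlt; exists a, b.
  exists m => // x Px; have [xlt|/(lt_le_trans mlt)/ltW//] := ltP x (a1 + b0).
  exact: mmin.
exists (a1 + b0) => // x Px; rewrite leNgt; apply/negP => xlt.
by apply: no; exists x.
Qed.
End ExpoSets.

Section Convolution.
Context {d : Order.disp_t} {W : orderType d} {K : fieldType}.
Implicit Types (x y z : expo W -> K) (g : expo W) (o : option W).

Definition supp x : set (expo W) := [set g | x g != 0].

(* The sum defaults to [0] when infinitely many terms are nonzero, which does not
   happen for well-ordered supports. *)
Definition hmul x y : expo W -> K :=
  fun g => \sum_(a \in [set: expo W]) x a * y (g - a).

Lemma hmul_seqE x y g (r : seq (expo W)) : uniq r ->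
  (forall a, x a != 0 -> y (g - a) != 0 -> a \in r) ->
  hmul x y g = \sum_(a <- r) x a * y (g - a).
Proof.
move=> ur rP; rewrite /hmul (fsbigTE [fset a | a in r]%fset).
  by apply: perm_big; rewrite uniq_perm// => a; rewrite !inE.
move=> a; rewrite inE /= => ar; apply/eqP; rewrite mulf_eq0.
by have [//|xa] := eqVneq (x a) 0; apply: contraNT ar; exact: rP.
Qed.

Lemma hmul_seq x y g : wo (supp x) -> wo (supp y) -> exists2 r : seq (expo W), uniq r &
  (forall a, x a != 0 -> y (g - a) != 0 -> a \in r).
Proof.
move=> wx wy; have /finite_seqP[s sE] := wo_pairs_finite g wx wy.
exists (undup s); rewrite ?undup_uniq// => a xa ya; rewrite mem_undup.
by have : [set a | supp x a /\ supp y (g - a)] a by []; rewrite sE.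
Qed.

Lemma hmul_neq0 x y g : hmul x y g != 0 -> exists2 a, x a != 0 & y (g - a) != 0.
Proof.
apply: contra_neqP => /forall2NP no; apply: fsbig1 => a _.
by have [/negP/negPn/eqP xa|/negP/negPn/eqP ya] := no a; rewrite ?xa ?ya ?mul0r ?mulr0.
Qed.

Lemma wo_hmul x y : wo (supp x) -> wo (supp y) -> wo (supp (hmul x y)).
Proof.
move=> wx wy; apply: wo_sub (wo_sumset wx wy) => g /hmul_neq0[a xa ya].
by exists a => //; exists (g - a); rewrite // addrC subrK.
Qed.

Lemma hmulC x y : hmul x y = hmul y x.
Proof.
apply/funext => g; rewrite /hmul (reindex_fsbigT (fun a => g - a)).
  by apply: eq_fsbigr => a _; rewrite subKr mulrC.
by exists (fun a => g - a) => a; rewrite subKr.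
Qed.

Lemma hmulDl x y z : wo (supp x) -> wo (supp y) -> wo (supp z) ->
  hmul (fun g => x g + y g) z = (fun g => hmul x z g + hmul y z g).
Proof.
move=> wx wy wz; apply/funext => g.
have [r ur rP] := hmul_seq g wx wz; have [s us sP] := hmul_seq g wy wz.
have ut : uniq (undup (r ++ s)) by exact: undup_uniq.
rewrite !(hmul_seqE ut) => [|a|a|a]; rewrite ?mem_undup ?mem_cat.
- by rewrite -big_split; apply: eq_bigr => a _; rewrite mulrDl.
- by move=> ya za; rewrite sP ?orbT.
- by move=> xa za; rewrite rP.
- have [->|xa _ za] := eqVneq (x a) 0; last by rewrite rP.
  by rewrite add0r => ya za; rewrite sP ?orbT.
Qed.

Lemma hmulA x y z : wo (supp x) -> wo (supp y) -> wo (supp z) ->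
  hmul x (hmul y z) = hmul (hmul x y) z.
Proof.
move=> wx wy wz; apply/funext => g.
have wyz := wo_sumset wy wz; have wxy := wo_sumset wx wy.
have /finite_seqP[s0 s0E] := wo_pairs_finite g wx wyz.
have /finite_seqP[r0 r0E] := wo_pairs_finite g wxy wz.
set s := undup s0; set r := undup r0.
have sP a : x a != 0 -> [set b + c | b in supp y & c in supp z] (g - a) -> a \in s.
  move=> xa yza; rewrite mem_undup.
  by have : [set a | supp x a /\ [set b + c | b in supp y & c in supp z] (g - a)] a
    by []; rewrite s0E.
have rP c : z (g - c) != 0 -> [set a + b | a in supp x & b in supp y] c -> c \in r.
  move=> zc xyc; rewrite mem_undup.
  by have : [set c | [set a + b | a in supp x & b in supp y] c /\ supp z (g - c)] c
    by []; rewrite r0E.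
rewrite (hmul_seqE (undup_uniq s0)); last first.
  move=> a xa /hmul_neq0[b yb zb]; apply: sP => //.
  by exists b => //; exists (g - a - b); rewrite // addrC subrK.
rewrite (hmul_seqE (undup_uniq r0)); last first.
  move=> c /hmul_neq0[a xa ya] zc; apply: rP => //.
  by exists a => //; exists (c - a); rewrite // addrC subrK.
(* Both sides are sums over [a] and over [c = a + b], on finite lists containing all terms that
   contribute. *)
transitivity (\sum_(a <- s) \sum_(c <- r) x a * (y (c - a) * z (g - c))).
  apply: eq_bigr => a _; rewrite -big_distrr /=.
  have [->|xa] := eqVneq (x a) 0; first by rewrite !mul0r.
  congr (_ * _); have ur : uniq [seq c - a | c <- r].
    by rewrite map_inj_uniq ?undup_uniq// => b c /addIr.
  rewrite (hmul_seqE ur).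
    rewrite big_map; apply: eq_bigr => c _.
    by rewrite opprB addrA subrK.
  move=> b yb zb; apply/mapP; exists (a + b); last by rewrite addrC addKr.
  apply: rP; first by rewrite opprD addrA.
  by exists a => //; exists b.
rewrite exchange_big /=; apply: eq_big_seq => c _.
under eq_bigr do rewrite mulrA; rewrite -big_distrl /=.
have [->|zc] := eqVneq (z (g - c)) 0; first by rewrite !mulr0.
congr (_ * _); apply/esym/hmul_seqE; first exact: undup_uniq.
move=> a xa ya; apply: sP => //; exists (c - a) => //; exists (g - c) => //.
by rewrite addrC addrA subrK.
Qed.

(* Write [x] as a series in the variables outside the initial segment [o], with
   coefficients that are series in the variables of [o]: each of these coefficients
   only involves variables bounded by some [u] in [o]. The bound depends on the
   coefficient, otherwise multiples of variables outside [o] would destroy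
   completeness at the limits above [o]. *)
Definition tame o x : Prop := forall g, exists2 u, below o u &
  forall g', x g' != 0 -> eqout o g' g -> eqabove u g' g.

Lemma tameD o x y : tame o x -> tame o y -> tame o (fun g => x g + y g).
Proof.
move=> tx ty g; have [u uo ux] := tx g; have [v vo vy] := ty g.
exists (Order.max u v) => [|g' nz gg'].
  by case: leP.
have [xg|xg] := eqVneq (x g') 0.
  by apply: (@eqabove_le _ _ v); rewrite ?le_max ?lexx ?orbT//; apply: vy;
    rewrite // xg add0r in nz *.
by apply: (@eqabove_le _ _ u); rewrite ?le_max ?lexx//; exact: ux.
Qed.

(* A coefficient of the product only receives contributions from finitely many pairs
   of coefficients, because projecting away the variables of [o] is monotone and thus
   preserves well-ordered supports. *)
Lemma tame_hmul o x y : wo (supp x) -> wo (supp y) -> (exists u, below o u) ->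
  tame o x -> tame o y -> tame o (hmul x y).
Proof.
move=> wx wy [u0 u0o] tx ty g.
pose P (a0 : expo W) u := below o u /\ forall a b, x a != 0 -> y b != 0 ->
  eqout o a a0 -> eqout o b (g - a0) -> eqabove u (a + b) g.
(* [f a0] bounds the contribution to the coefficient at [g] that comes from the coefficients of [x]
   at [a0] and of [y] at [g - a0]. *)
have /choice[f fP] : forall a0, exists u, P a0 u.
  move=> a0; have [u uo ux] := tx a0; have [v vo vy] := ty (g - a0).
  exists (Order.max u v); split; first by case: leP.
  move=> a b xa yb aa0 ba0 t; rewrite gt_max => /andP[ut vt].
  by rewrite expoDE (ux _ xa aa0 t ut) (vy _ yb ba0 t vt) -expoDE addrC subrK.
have mono a b : a <= b -> proj o a <= proj o b := @proj_le _ _ o a b.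
have := wo_pairs_finite (proj o g) (wo_image mono wx) (wo_image mono wy).
set F := [set _ | _] => finF.
(* [0] is added to keep the set nonempty when no coefficients contribute. *)
have [||u [v Fv <-] umax] := finite_max (finite_image f (_ : finite_set (F `|` [set 0]))).
- by rewrite finite_setU; split=> //; exact: finite_set1.
- by exists (f 0); exists 0 => //; right.
exists (f v) => [|g' /hmul_neq0[a xa ya] gg']; first by case: (fP v).
have Fa : F (proj o a).
  split; first by exists a.
  exists (g' - a) => //; rewrite projD projN; congr (_ - _).
  exact/projP.
apply: (@eqabove_le _ _ (f (proj o a))).
  by apply: umax; exists (proj o a) => //; left.
have [_ /(_ a (g' - a) xa ya)] := fP (proj o a).
rewrite [a + _]addrC subrK; apply; first by apply/projP; rewrite proj_idem.
by apply/projP; rewrite !projD !projN proj_idem; congr (_ - _); exact/projP.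
Qed.
End Convolution.

(** * Inverses of series *)

Section Inverse.
Context {d : Order.disp_t} {W : orderType d} {K : fieldType}.
Implicit Types (x y w : expo W -> K) (g : expo W) (o : option W).

Definition hone : expo W -> K := fun g => (g == 0)%:R.

Lemma hone_mul x : hmul hone x = x.
Proof.
apply/funext => g; rewrite (@hmul_seqE _ _ _ _ _ _ [:: 0])//.
  by rewrite big_seq1 /hone eqxx mul1r subr0.
by move=> a; rewrite /hone inE; case: (a =P 0) => //; rewrite eqxx.
Qed.

Lemma hmul_low x y a b : (forall g, g < a -> x g = 0) -> (forall g, g < b -> y g = 0) ->
  forall g, g < a + b -> hmul x y g = 0.
Proof.
move=> xa yb g; apply: contraTeq => /hmul_neq0[c xc yc]; rewrite -leNgt.
have ac : a <= c by rewrite leNgt; apply: contra_neqN xc; exact: xa.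
have bc : b <= g - c by rewrite leNgt; apply: contra_neqN yc; exact: yb.
by apply: (@le_trans _ _ (c + b)); rewrite ?leD2r// -[g](subrK c) [c + b]addrC leD2r.
Qed.

Lemma hmul_lead x y a b : (forall g, g < a -> x g = 0) -> (forall g, g < b -> y g = 0) ->
  hmul x y (a + b) = x a * y b.
Proof.
move=> xa yb; rewrite (@hmul_seqE _ _ _ _ _ _ [:: a])//.
  by rewrite big_seq1 addrC addKr.
move=> c xc yc; rewrite inE eq_le; apply/andP; split; last first.
  by rewrite leNgt; apply: contra_neqN xc; exact: xa.
have bc : b <= a + b - c by rewrite leNgt; apply: contra_neqN yc; exact: yb.
by move: bc; rewrite addrAC -{1}[b]add0r leD2r leBr0.
Qed.

Lemma hmul_local x w w' g : (forall a, x a != 0 -> w (g - a) = w' (g - a)) ->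
  hmul x w g = hmul x w' g.
Proof.
move=> E; apply: eq_fsbigr => a _.
by have [->|/E->//] := eqVneq (x a) 0; rewrite !mul0r.
Qed.

(** Only the terms at [a = 0] can differ. This isolates the value of [w] at [g] in the recursion
    that determines an inverse. *)
Lemma hmul_diff x w w' g : wo (supp x) -> wo (supp w) -> wo (supp w') ->
  (forall a, x a != 0 -> a != 0 -> w (g - a) = w' (g - a)) ->
  hmul x w g - hmul x w' g = x 0 * (w g - w' g).
Proof.
move=> wx ww ww' E.
have [r ur rP] := hmul_seq g wx ww; have [s us sP] := hmul_seq g wx ww'.
have ut : uniq (undup (0 :: r ++ s)) by exact: undup_uniq.
rewrite !(hmul_seqE ut) => [|a xa wa|a xa wa].
- rewrite -sumrB (bigD1_seq 0) ?mem_undup ?inE ?eqxx//= big1 => [|a a0].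
    by rewrite addr0 !subr0 -mulrBr.
  have [->|xa] := eqVneq (x a) 0; first by rewrite !mul0r subrr.
  by rewrite E// subrr.
- by rewrite mem_undup inE mem_cat sP ?orbT.
- by rewrite mem_undup inE mem_cat rP ?orbT.
Qed.

Lemma wo_hone : wo (supp hone).
Proof.
apply: wo_sub (@wo_set1 _ _ (0 : expo W)) => g; rewrite /supp /hone /=.
by case: (g =P 0); rewrite ?eqxx.
Qed.

Section PartialInverse.
Variables (x : expo W -> K).
Hypotheses (wx : wo (supp x)) (xge0 : forall g, x g != 0 -> 0 <= g) (x0 : x 0 != 0).

Definition partial_inv (I : set (expo W)) w : Prop :=
  [/\ forall g h, g <= h -> I h -> I g, supp w `<=` I `&` [set g | 0 <= g],
      wo (supp w) & forall g, I g -> hmul x w g = hone g].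

(** At the least exponent [h] where the two differ, the products with [x] differ by
    [x 0 * (w h - w' h)], although both equal [hone h]. *)
Lemma partial_inv_uniq I J w w' g :
  partial_inv I w -> partial_inv J w' -> I g -> J g -> w g = w' g.
Proof.
move=> [Idown _ ww Iw] [Jdown _ ww' Jw'] Ig Jg; apply: contrapT => ne.
pose P := [set h | [/\ I h, J h & w h <> w' h]].
have [||h [Ih Jh nh] hmin] := woU ww ww' (_ : P `<=` _).
- move=> h [_ _ nh]; have [wh|wh] := eqVneq (w h) 0; last by left.
  by right; apply: contra_notN nh; rewrite wh => /eqP->.
- by exists g.
apply: nh; apply/eqP; rewrite -subr_eq0 -(mulrI_eq0 _ (mulfI x0)).
rewrite -(@hmul_diff x w w' h)// ?Iw ?Jw' ?subrr// => a xa a0.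
apply: contrapT => nha.
have ap : h - a < h by rewrite ltBl_gt0 lt_neqAle eq_sym a0 xge0.
have := hmin (h - a); rewrite leNgt ap => /(_ _)/notF; apply; split=> //.
  exact: Idown (ltW ap) Ih.
exact: Jdown (ltW ap) Jh.
Qed.

(* Partial inverses on initial segments of the exponents are unique, so they glue to a
   largest one; the first exponent where this one fails could be corrected. *)
Lemma hmul_inv : exists w, [/\ wo (supp w), forall g, w g != 0 -> 0 <= g & hmul x w = hone].
Proof.
pose D g (Iw : set (expo W) * (expo W -> K)) := partial_inv Iw.1 Iw.2 /\ Iw.1 g.
(* [w g] is read off some partial inverse defined at [g], and is [0] where there is none. *)
pose w g := if pselect (exists Iw, D g Iw) is left e then (projT1 (cid e)).2 g else 0.
pose U := [set g | exists Iw, D g Iw].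
have wE I v g : partial_inv I v -> I g -> w g = v g.
  move=> Iv Ig; rewrite /w; case: pselect => [e|[]]; last by exists (I, v).
  by case: cid => -[J v'] [/= Jv' Jg]; exact: partial_inv_uniq Jv' Iv Jg Ig.
have wU g : w g != 0 -> U g.
  by rewrite /w; case: pselect => // _; rewrite eqxx.
have Udown g h : g <= h -> U h -> U g.
  move=> gh [[I v] [[Idown ? ? ?] Ih]]; exists (I, v); split=> //; exact: Idown Ih.
have woW : wo (supp w).
  move=> P PW [g Pg]; have [[I v] [/= Iv Ig]] := wU g (PW g Pg).
  have [Idown _ wov _] := Iv.
  have [||m [Pm Im] mmin] := wov (P `&` I).
  - by move=> h [Ph Ih]; rewrite /supp /= -(wE _ _ _ Iv Ih); exact: PW.
  - by exists g.
  exists m => // h Ph; have [hm|/ltW//] := leP h m.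
  by apply: mmin; split=> //; exact: Idown hm Im.
have w0 g : w g != 0 -> 0 <= g.
  move=> wg; have [[I v] [/= Iv Ig]] := wU g wg; have [_ sub _ _] := Iv.
  by have [] := sub g; rewrite // /supp /= -(wE _ _ _ Iv Ig).
have pU : partial_inv U w.
  split=> // [g wg|g [[I v] [/= Iv Ig]]]; first by split; [exact: wU|exact: w0].
  have [Idown _ _ <-//] := Iv; apply: hmul_local => a xa; apply: (wE I) => //.
  by apply: Idown Ig; rewrite leBl_ge0 xge0.
exists w; split=> //; apply/funext => g; apply: contrapT => ng.
pose Z := [set h | hmul x w h <> hone h].
have [||g0 Zg0 gmin] := woU (wo_hmul wx woW) wo_hone (_ : Z `<=` _).
- move=> h Zh; rewrite /supp /=; have [xwh|] := eqVneq (hmul x w h) 0; last by left.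
  by right; apply: contra_notN Zh; rewrite xwh => /eqP->.
- by exists g.
have nU : ~ U g0 by case: pU => _ _ _ E /E.
have g00 : 0 <= g0.
  rewrite leNgt; apply/negP => g0lt; apply: Zg0; rewrite /hone (lt_eqF g0lt).
  rewrite (@hmul_low _ _ 0 0) ?addr0// => h; apply: contraTeq; rewrite -leNgt.
    exact: xge0.
  exact: w0.
(* The product is correct below [g0]. Placing [c] at [g0] changes it there by [x 0 * c], which is
   the defect, so the result is a partial inverse on all exponents up to [g0]. *)
apply: (nU); pose c := (hone g0 - hmul x w g0) / x 0.
pose w' h := if h == g0 then c else w h.
have ww' : wo (supp w').
  apply: wo_sub (woU woW (@wo_set1 _ _ g0)) => h; rewrite /supp /w' /=.
  by case: (h =P g0); [right|left].
have wg0 : w g0 = 0 by apply/eqP/negPn/negP => /wU; case: pU => _ _ _ E /E.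
rewrite /U /=; exists ([set h | h <= g0], w'); split=> /=; last by rewrite lexx.
split=> // [h k hk kg0|h|h].
- exact: le_trans hk kg0.
- rewrite /supp /w' /=; case: (h =P g0) => [->|_ wh]; first by split=> /=.
  split; last exact: w0.
  rewrite /= leNgt; apply/negP => g0h; exact: nU (Udown _ _ (ltW g0h) (wU h wh)).
move=> /=; rewrite le_eqVlt => /orP[/eqP->|hg0].
  apply/eqP; rewrite -[X in X == _](subrK (hmul x w g0)).
  rewrite hmul_diff// => [|a _ a0]; first by rewrite /w' eqxx wg0 subr0 mulrC divfK// subrK.
  by rewrite /w'; case: eqP => // /eqP; rewrite subr_eq addrC -subr_eq subrr eq_sym (negPf a0).
transitivity (hmul x w h); last first.
  by apply: contrapT => /gmin; rewrite leNgt hg0.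
apply: hmul_local => a xa; rewrite /w' lt_eqF//.
by apply: le_lt_trans hg0; rewrite leBl_ge0 xge0.
Qed.

(* At the least exponent outside [o] whose coefficient in [w] is not tame, all other
   contributions to [x * w = 1] are tame, and [x] has a tame coefficient there. *)
Lemma tame_inv o w : (exists u, below o u) -> wo (supp w) -> hmul x w = hone ->
  tame o x -> tame o w.
Proof.
move=> [u0 u0o] ww xw tx.
pose good g := exists2 u, below o u &
  forall g', w g' != 0 -> eqout o g' g -> eqabove u g' g.
move=> g; apply: contrapT => bad_g.
have mono a b : a <= b -> proj o a <= proj o b := @proj_le _ _ o a b.
have [||_ [g1 bad_g1 <-] hmin] := wo_image mono ww (_ : proj o @` [set g | ~ good g] `<=` _).
- move=> _ [h bad <-]; apply: contrapT => no; apply: bad; exists u0 => // g' wg' gh.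
  by case: no; exists g' => //; exact/projP.
- by exists (proj o g); exists g.
(* [v] collects the coefficients of [w] that precede the one at [g1]; by minimality they are all
   good, so [v] is tame. *)
pose v g := if proj o g < proj o g1 then w g else 0.
have wv : wo (supp v).
  by apply: wo_sub ww => h; rewrite /supp /v /=; case: ifP; rewrite ?eqxx.
have tv : tame o v.
  move=> h; have [[u uo uP]|bad] := pselect (good h).
    exists u => // g'; rewrite /v; case: ifP; rewrite ?eqxx// => _; exact: uP.
  exists u0 => // g'; rewrite /v; case: ifP; rewrite ?eqxx// => lt _ /projP E.
  by have := hmin _ (ex_intro2 _ _ h bad erefl); rewrite -E leNgt lt.
have [u1 u1o u1P] := tame_hmul wx wv (ex_intro _ u0 u0o) tx tv g1.
have [u2 u2o u2P] := tx 0.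
have [u3 u3o u3P] : exists2 u, below o u & (eqout o 0 g1 -> eqabove u 0 g1).
  have [/(eqout_eqabove u0o)[u uo uP]|no] := pselect (eqout o 0 g1); first by exists u.
  by exists u0.
apply: bad_g1; exists (Order.max u1 (Order.max u2 u3)) => [|g' wg' g'1].
  by case: (leP u2 u3) => _; case: leP.
set u := Order.max _ _; apply: contrapT => nu.
(* Let [g0] be the least exponent violating the bound [u] in the coefficient of [w] at [g1]. The
   difference of [x * w] and [x * v] at [g0] will be [x 0 * w g0], which is nonzero, while both
   products vanish at [g0]. *)
pose Y := [set h | [/\ w h != 0, eqout o h g1 & ~ eqabove u h g1]].
have [||g0 [wg0 g01 ng0] g0min] := ww Y.
- by move=> h [].
- by exists g'.
have u1u : u1 <= u by rewrite le_max lexx.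
have u2u : u2 <= u by rewrite !le_max lexx orbT.
have u3u : u3 <= u by rewrite !le_max lexx !orbT.
have vg0 : v g0 = 0 by rewrite /v (_ : proj o g0 = proj o g1) ?ltxx//; exact/projP.
have := @hmul_diff x w v g0 wx ww wv; rewrite xw vg0 subr0 => /(_ _)E.
have : x 0 * w g0 != 0 by rewrite mulf_neq0.
rewrite -E => [|a xa a0].
  apply/negP; rewrite negbK subr_eq0; apply/eqP.
  transitivity (0 : K).
    rewrite /hone; case: eqP => // g00; case: ng0; apply: (eqabove_le u3u).
    by rewrite g00; apply: u3P; rewrite -g00.
  by apply/esym/eqP/negPn/negP => nz; apply: ng0; apply: (eqabove_le u1u); exact: u1P.
(* If a further [a] contributed, then [g0 - a] would lie in the coefficient at [g1], so [a] would
   have no variables outside [o] and, by the choice of [u2], none above [u]. Then [g0 - a] would be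
   a smaller exponent violating the bound. *)
have a_gt0 : 0 < a by rewrite lt_neqAle eq_sym a0 xge0.
rewrite /v; case: ifPn => // /negP nlt; apply/eqP/negPn/negP => wga.
have pa : proj o (g0 - a) = proj o g1.
  apply/eqP; rewrite eq_le leNgt; apply/andP; split; last by rewrite leNgt; apply/negP.
  rewrite -(_ : proj o g0 = proj o g1); last exact/projP.
  by rewrite -leNgt proj_le// leBl_ge0 ltW.
have pa0 : eqout o a 0.
  apply/projP; rewrite proj0; move: pa; rewrite projD projN -(_ : proj o g0 = proj o g1).
    by move/eqP; rewrite subr_eq addrC -subr_eq subrr eq_sym => /eqP.
  exact/projP.
have := g0min (g0 - a); rewrite leNgt ltBl_gt0 a_gt0 => /(_ _)/notF; apply; split=> //.
  exact/projP.
move=> E'; apply: ng0 => t ut; rewrite -(E' t ut) expoDE expoNE.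
by rewrite (u2P a xa pa0 t (le_lt_trans u2u ut)) subr0.
Qed.
End PartialInverse.
End Inverse.

(** * The ring of tame Hahn series *)

Section HahnRing.
Context {d : Order.disp_t} {W : orderType d}.
Variables (K : fieldType) (C : set (option W)).
Implicit Types (f : expo W -> K) (g h : expo W) (o : option W).

(** Tameness is asked only at nonempty segments, because the bound has to lie in the segment. *)
Definition hgood f : Prop := [/\ wo (supp f), forall g, f g != 0 -> 0 <= g &
  forall o, C o -> (exists u, below o u) -> tame o f].

Record hahn := Hahn { hc :> expo W -> K; hcP : hgood hc }.
Implicit Types (x y : hahn).

HB.instance Definition _ := gen_eqMixin hahn.
HB.instance Definition _ := gen_choiceMixin hahn.

Lemma hahnP x y : (forall g, x g = y g) -> x = y.
Proof.
case: x y => [x xP] [y yP] /= xy; have E : x = y by apply/funext.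
by case: _ / E yP {xy} => yP; congr Hahn; exact: Prop_irrelevance.
Qed.

Lemma hgood_finite f : finite_set (supp f) -> (forall g, f g != 0 -> 0 <= g) -> hgood f.
Proof.
move=> fin f0; split=> // [|o _ [u0 u0o] g]; first exact: wo_finite.
have /choice[v vP] : forall h, exists u, below o u /\ (eqout o h g -> eqabove u h g).
  move=> h; have [/(eqout_eqabove u0o)[u uo uP]|no] := pselect (eqout o h g).
    by exists u.
  by exists u0.
have [||u [w Fw <-] umax] := finite_max (finite_image v (_ : finite_set (supp f `|` [set 0]))).
- by rewrite finite_setU; split=> //; exact: finite_set1.
- by exists (v 0); exists 0 => //; right.
exists (v w) => [|g' fg' gg']; first by case: (vP w).
apply: (@eqabove_le _ _ (v g')); last by case: (vP g') => _; exact.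
by apply: umax; exists g' => //; left.
Qed.

Fact hahn0_subproof : hgood (fun=> 0).
Proof.
apply: hgood_finite => [|g]; last by rewrite eqxx.
by apply: sub_finite_set (@finite_set0 _) => g; rewrite /supp /= eqxx.
Qed.
Definition hahn0 := Hahn hahn0_subproof.

Fact hahnN_subproof x : hgood (fun g => - x g).
Proof.
have [wx x0 tx] := hcP x; split=> [|g|o Co o0 g]; rewrite /supp /=.
- by apply: wo_sub wx => g; rewrite /supp /= oppr_eq0.
- by rewrite oppr_eq0; exact: x0.
- by have [u uo uP] := tx o Co o0 g; exists u => // g'; rewrite oppr_eq0; exact: uP.
Qed.
Definition hahnN x := Hahn (hahnN_subproof x).

Fact hahnD_subproof x y : hgood (fun g => x g + y g).
Proof.
have [wx x0 tx] := hcP x; have [wy y0 ty] := hcP y; split=> [|g|o Co o0].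
- apply: wo_sub (woU wx wy) => g; rewrite /supp /=.
  by have [->|] := eqVneq (x g) 0; [rewrite add0r; right|left].
- by have [->|/x0//] := eqVneq (x g) 0; rewrite add0r; exact: y0.
- by apply: tameD; [exact: tx|exact: ty].
Qed.
Definition hahnD x y := Hahn (hahnD_subproof x y).

Fact hahn_addA : associative hahnD. Proof. by move=> *; apply: hahnP => g /=; rewrite addrA. Qed.
Fact hahn_addC : commutative hahnD. Proof. by move=> *; apply: hahnP => g /=; rewrite addrC. Qed.
Fact hahn_add0 : left_id hahn0 hahnD. Proof. by move=> *; apply: hahnP => g /=; rewrite add0r. Qed.
Fact hahn_addN : left_inverse hahn0 hahnN hahnD.
Proof. by move=> *; apply: hahnP => g /=; rewrite addNr. Qed.
HB.instance Definition _ := GRing.isZmodule.Build hahn hahn_addA hahn_addC hahn_add0 hahn_addN.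

Fact hahn1_subproof : hgood hone.
Proof.
apply: hgood_finite => [|g]; last by rewrite /hone; case: (g =P 0) => [->|]; rewrite ?eqxx.
by apply: sub_finite_set (finite_set1 0) => g; rewrite /supp /hone /=; case: (g =P 0); rewrite ?eqxx.
Qed.
Definition hahn1 := Hahn hahn1_subproof.

Fact hahnM_subproof x y : hgood (hmul x y).
Proof.
have [wx x0 tx] := hcP x; have [wy y0 ty] := hcP y; split=> [|g|o Co o0].
- exact: wo_hmul.
- by move=> /hmul_neq0[a /x0 xa /y0 ya]; rewrite -(subrK a g) expo_addr_ge0.
- by apply: tame_hmul => //; [exact: tx|exact: ty].
Qed.
Definition hahnM x y := Hahn (hahnM_subproof x y).

Lemma wo_hahn x : wo (supp x). Proof. by have [] := hcP x. Qed.
Lemma hahn_ge0 x g : x g != 0 -> 0 <= g. Proof. by have [_ + _] := hcP x; exact. Qed.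
#[local] Hint Resolve wo_hahn : core.

Fact hahn_mulA : associative hahnM.
Proof. by move=> x y z; apply: hahnP => g /=; rewrite hmulA. Qed.
Fact hahn_mulC : commutative hahnM.
Proof. by move=> x y; apply: hahnP => g /=; rewrite hmulC. Qed.
Fact hahn_mul1 : left_id hahn1 hahnM.
Proof. by move=> x; apply: hahnP => g /=; rewrite hone_mul. Qed.
Fact hahn_mulDl : left_distributive hahnM hahnD.
Proof. by move=> x y z; apply: hahnP => g /=; rewrite hmulDl. Qed.
Fact hahn_1_neq0 : hahn1 != hahn0.
Proof.
apply/eqP => /(congr1 (fun x : hahn => x 0)) /= /eqP.
by rewrite /hone eqxx oner_eq0.
Qed.
HB.instance Definition _ := GRing.Zmodule_isComNzRing.Build hahn
  hahn_mulA hahn_mulC hahn_mul1 hahn_mulDl hahn_1_neq0.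

Lemma hahnDE x y g : (x + y) g = x g + y g. Proof. by []. Qed.
Lemma hahnBE x y g : (x - y) g = x g - y g. Proof. by []. Qed.
Lemma hahn0E g : (0 : hahn) g = 0. Proof. by []. Qed.
Lemma hahn1E g : (1 : hahn) g = (g == 0)%:R. Proof. by []. Qed.
Lemma hahnME x y : (x * y : hahn) = hmul x y :> (expo W -> K). Proof. by []. Qed.

Lemma hahn_lt0 x g : g < 0 -> x g = 0.
Proof. by move=> g0; apply: contraTeq g0 => /hahn_ge0; rewrite leNgt. Qed.

Lemma hahnM0 x y : (x * y) 0 = x 0 * y 0.
Proof. by rewrite hahnME -[X in hmul _ _ X]addr0 hmul_lead// => g; exact: hahn_lt0. Qed.

Lemma hahn_inv_ex x : x 0 != 0 -> exists y, y * x = 1.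
Proof.
move=> x0; have [wx xge0 tx] := hcP x.
have [w [ww w0 xw]] := hmul_inv wx xge0 x0.
have wP : hgood w.
  by split=> // o Co o0; apply: (tame_inv wx xge0 x0 o0 ww xw); exact: tx.
by exists (Hahn wP); rewrite mulrC; apply: hahnP => g; rewrite hahnME /= xw.
Qed.

Definition hahn_unit : {pred hahn} := [pred x : hahn | x 0 != 0].
Definition hahn_inv x : hahn :=
  if pselect (exists y, y * x = 1) is left e then projT1 (cid e) else x.

Fact hahn_mulVx : {in hahn_unit, left_inverse 1 hahn_inv *%R}.
Proof.
move=> x; rewrite inE => /hahn_inv_ex x0; rewrite /hahn_inv.
by case: pselect => // e; case: cid.
Qed.

Fact hahn_unitPl x y : y * x = 1 -> hahn_unit x.
Proof.
move=> /(congr1 (fun x : hahn => x 0)); rewrite hahnM0 hahn1E eqxx /= => E.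
by apply/eqP => x0; move: E; rewrite x0 mulr0 => /eqP; rewrite eq_sym oner_eq0.
Qed.

Fact hahn_invr_out : {in [predC hahn_unit], hahn_inv =1 id}.
Proof.
move=> x; rewrite inE /= => /negP nu; rewrite /hahn_inv.
by case: pselect => // e; case: nu; case: e => y yx; exact: hahn_unitPl yx.
Qed.

HB.instance Definition _ := GRing.ComNzRing_hasMulInverse.Build hahn
  hahn_mulVx hahn_unitPl hahn_invr_out.

Lemma hahn_unitE x : (x \is a GRing.unit) = (x 0 != 0). Proof. by []. Qed.

Lemma hahn_least x : x != 0 -> exists2 g, x g != 0 & forall h, h < g -> x h = 0.
Proof.
move=> x0; have [|g xg gmin] := wo_hahn (@subset_refl _ (supp x)).
  apply: contrapT => no; move/eqP: x0; apply; apply: hahnP => g; rewrite hahn0E.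
  by apply: contrapT => /eqP nz; apply: no; exists g.
by exists g => // h; apply: contraTeq => /gmin; rewrite leNgt.
Qed.

Fact hahn_idomain x y : x * y = 0 -> (x == 0) || (y == 0).
Proof.
move=> xy; have [//|/hahn_least[a xa xlt]] := eqVneq x 0.
have [//|/hahn_least[b yb ylt]] := eqVneq y 0.
have := congr1 (fun x : hahn => x (a + b)) xy; rewrite hahnME hmul_lead// => /eqP.
by rewrite mulf_eq0 (negPf xa) (negPf yb).
Qed.
HB.instance Definition _ := GRing.ComUnitRing_isIntegral.Build hahn hahn_idomain.

Fact hterm_subproof (a : K) g : hgood (fun h => if (0 <= g) && (h == g) then a else 0).
Proof.
apply: hgood_finite => [|h]; last by case: ifP => [/andP[? /eqP->]|]; rewrite ?eqxx.
apply: sub_finite_set (finite_set1 g) => h; rewrite /supp /=.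
by case: ifP => [/andP[_ /eqP->]|]; rewrite ?eqxx.
Qed.
(** The monomial with coefficient [a] and exponent [g], set to [0] for negative [g] so that it is
    defined for every exponent. *)
Definition hterm a g : hahn := Hahn (hterm_subproof a g).

Lemma htermE a g h : 0 <= g -> hterm a g h = if h == g then a else 0.
Proof. by rewrite /= => ->. Qed.

Lemma hterm_mulE a g x h : 0 <= g -> (hterm a g * x) h = a * x (h - g).
Proof.
move=> g0; rewrite hahnME (@hmul_seqE _ _ _ _ _ _ [:: g])//.
  by rewrite big_seq1 htermE// eqxx.
by move=> b; rewrite htermE// inE; case: (b =P g) => //; rewrite eqxx.
Qed.

Lemma hterm_mul a b g h : 0 <= g -> 0 <= h -> hterm a g * hterm b h = hterm (a * b) (g + h).
Proof.
move=> g0 h0; apply: hahnP => k; rewrite hterm_mulE// !htermE ?expo_addr_ge0//.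
by rewrite subr_eq [h + g]addrC; case: eqP; rewrite ?mulr0.
Qed.


Lemma hterm1_neq0 g : 0 <= g -> hterm 1 g != 0.
Proof.
move=> g0; apply/eqP => /(congr1 (fun x : hahn => x g)) /eqP.
by rewrite htermE// eqxx oner_eq0.
Qed.

(** Division by the monomial of exponent [g]: translations permute the coefficients over each
    segment and so preserve tameness. *)
Fact hshift_subproof x g : (forall h, h < g -> x h = 0) -> hgood (fun h => x (h + g)).
Proof.
have [wx _ tx] := hcP x => xlow; split=> [|h|o Co o0 h].
- apply: (@wo_sub _ _ _ ((fun h => h - g) @` supp x)).
    by move=> h xh; exists (h + g); rewrite // addrK.
  by apply: wo_image wx => a b ab; rewrite leD2r.
- apply: contraNT; rewrite -ltNge => h0; apply/eqP/xlow.
  by rewrite -[X in _ < X]add0r ltD2r.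
have [u uo uP] := tx o Co o0 (h + g); exists u => // h' xh' hh' t ut.
have E : eqout o (h' + g) (h + g) by move=> s ns; rewrite !expoDE hh'.
by have := uP _ xh' E t ut; rewrite !expoDE => /addIr.
Qed.

Lemma dvd_hterm g x : 0 <= g ->
  dvdR (hterm 1 g) x <-> (forall h, h < g -> x h = 0).
Proof.
move=> g0; split=> [[c ->] h hg|xlow].
  rewrite mulrC hterm_mulE// hahn_lt0 ?mulr0//.
  by rewrite -(ltD2r g) subrK add0r.
exists (Hahn (hshift_subproof xlow)); apply: hahnP => h.
by rewrite mulrC hterm_mulE// mul1r /= subrK.
Qed.

(** Dividing by the monomial of the least exponent leaves a nonzero constant term. Divisibility thus
    reduces to comparing exponents in a totally ordered group. *)
Lemma hahn_factor x : x != 0 -> exists g, exists c : hahn,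
  [/\ 0 <= g, c \is a GRing.unit & x = c * hterm 1 g].
Proof.
move=> /hahn_least[g xg xlow]; have g0 := hahn_ge0 xg.
have [c xc] := (dvd_hterm x g0).2 xlow; exists g, c; split=> //.
by move: xg; rewrite xc mulrC hterm_mulE// mul1r subrr hahn_unitE.
Qed.

Lemma hahn_valuation : valuation_domain hahn.
Proof.
move=> x y; have [->|/hahn_factor[g [c [g0 cu ->]]]] := eqVneq x 0.
  by right; exists 0; rewrite mul0r.
have [->|/hahn_factor[h [e [h0 eu ->]]]] := eqVneq y 0.
  by left; exists 0; rewrite mul0r.
have aux (a b : expo W) (p q : hahn) : 0 <= a -> a <= b -> p \is a GRing.unit ->
    dvdR (p * hterm 1 a) (q * hterm 1 b).
  move=> a0 ab pu; exists (q / p * hterm 1 (b - a)).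
  rewrite mulrACA divrK// hterm_mul ?mulr1 ?leBr0//.
  by rewrite subrK.
by have [gh|/ltW hg] := leP g h; [left|right]; apply: aux.
Qed.

Definition hresidue (x : hahn) : K := x 0.
Fact hresidue_is_zmod_morphism : zmod_morphism hresidue. Proof. by []. Qed.
Fact hresidue_is_monoid_morphism : monoid_morphism hresidue.
Proof. by split=> [|x y]; rewrite /hresidue ?hahnM0// hahn1E eqxx. Qed.
HB.instance Definition _ := GRing.isZmodMorphism.Build hahn K hresidue hresidue_is_zmod_morphism.
HB.instance Definition _ := GRing.isMonoidMorphism.Build hahn K hresidue hresidue_is_monoid_morphism.

Lemma hahn_residue : residue_field_is hahn K.
Proof.
exists hresidue; split=> [k|x].
  by exists (hterm k 0); rewrite -[LHS]/(hterm k 0 0) htermE// eqxx.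
by rewrite hahn_unitE negbK; apply: rwP; exact: eqP.
Qed.
End HahnRing.

(** * Combinatorics of the first uncountable ordinal *)

Lemma countable_enum T (A : set T) a0 : countable A -> A a0 ->
  exists e : nat -> T, (forall n, A (e n)) /\ forall a, A a -> exists n, e n = a.
Proof.
move=> /countable_injP[f finj] Aa0.
pose P n a := A a /\ ((exists2 b, A b & f b = n) -> f a = n).
have /choice[e eP] : forall n, exists a, P n a.
  move=> n; have [[b Ab fb]|no] := pselect (exists2 b, A b & f b = n).
    by exists b.
  by exists a0.
exists e; split=> [n|a Aa]; first by case: (eP n).
exists (f a); apply: finj; rewrite ?inE//; first by case: (eP (f a)).
by case: (eP (f a)) => _; apply; exists a.
Qed.

Section OmegaOne.
Context {d : Order.disp_t} {W : orderType d}.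
Let lt := fun x y : W => is_true (x < y).
Hypothesis HW : is_omega1 lt.

Lemma countable_predE (P : W -> Prop) : countable_pred P <-> countable [set x | P x].
Proof.
split=> [[f finj]|/countable_injP[f finj]].
  by apply/countable_injP; exists f => x y; rewrite !inE => Px Py; exact: finj.
by exists f => x y Px Py; apply: finj; rewrite inE.
Qed.

Lemma omega1_wf : well_founded lt. Proof. by case: HW => _ [_ [_ []]]. Qed.

Lemma omega1_initial x : countable [set y : W | y < x].
Proof. by case: HW => _ [_ [_ [_ [_ H]]]]; apply/countable_predE; exact: H. Qed.

(** Otherwise [W] would be the union of the countably many closed initial segments given by [A],
    each of which is countable. *)
Lemma omega1_bounded (A : set W) : countable A -> exists b, forall a, A a -> a < b.
Proof.
move=> cA; apply: contrapT => no; case: HW => _ [_ [_ [_ [H _]]]]; apply: H.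
apply/countable_predE.
apply: (@sub_countable _ _ _ (\bigcup_(a in A) ([set y | y < a] `|` [set a]))).
  apply: subset_card_le => y _; apply: contrapT => ny; apply: no; exists y => a Aa.
  rewrite ltNge le_eqVlt; apply/negP => /orP ya; apply: ny; exists a => //.
  by case: ya => [/eqP->|ya]; [right|left].
apply: bigcup_countable => // a _.
apply: (@sub_countable _ _ _ (\bigcup_(b in [set: bool])
  (if b then [set y | y < a] else [set a]))).
  by apply: subset_card_le => y [ya|ya]; [exists true|exists false].
apply: bigcup_countable => // -[] _; [exact: omega1_initial|exact: countable1].
Qed.

Lemma omega1_succ x : exists y : W, x < y.
Proof. by have [b bP] := omega1_bounded (countable1 x); exists b; exact: bP. Qed.

Lemma omega1_least (P : set W) : P !=set0 -> exists2 m, P m & forall x, P x -> m <= x.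
Proof.
move=> [x Px]; apply: contrapT => no; elim/(well_founded_ind omega1_wf) : x Px => x IH Px.
by apply: no; exists x => // y Py; rewrite leNgt; apply/negP => /IH; exact.
Qed.

(** [D] is the supremum of an increasing sequence in which [u n.+1] exceeds the values of [F] on the
    segment up to [u n]. *)
Lemma omega1_closure (F : W -> W) x : exists D, [/\ x < D, is_limit lt D &
  forall b, b < D -> F b < D].
Proof.
have /choice[s sP] : forall u, exists v, u < v /\ forall b, b <= u -> F b < v.
  move=> u; have [u' uu'] := omega1_succ u.
  have := omega1_bounded (_ : countable ([set u] `|` F @` [set b | b < u'])).
  case.
    apply: (@sub_countable _ _ _ (\bigcup_(b in [set: bool])
      (if b then [set u] else F @` [set b | b < u']))).
      by apply: subset_card_le => y [ya|ya]; [exists true|exists false].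
    apply: bigcup_countable => // -[] _; first exact: countable1.
    exact: (sub_countable (card_image_le _ _) (omega1_initial _)).
  move=> v vP; exists v; split; first by apply: vP; left.
  by move=> b bu; apply: vP; right; exists b => //=; exact: le_lt_trans uu'.
pose u n := iter n s x.
have [|D Dub Dmin] := @omega1_least [set D | forall n, u n < D].
  have cu : countable (range u).
    exact: (sub_countable (card_image_le _ _) (countableP _)).
  have [b bP] := omega1_bounded cu.
  by exists b => n; apply: bP; exists n.
have cof b : b < D -> exists n, b <= u n.
  move=> bD; apply: contrapT => no; have := Dmin b; rewrite leNgt bD => /(_ _)/notF; apply.
  by move=> n; rewrite ltNge; apply/negP => bn; apply: no; exists n.
exists D; split; first exact: (Dub 0).
  split; first by exists x; exact: (Dub 0).
  move=> b bD; have [n bn] := cof b bD; exists (u n.+1); split; last exact: Dub.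
  by apply: le_lt_trans bn _; case: (sP (u n)).
move=> b /cof[n bn]; apply: lt_trans (Dub n.+1).
by case: (sP (u n)) => _; exact.
Qed.

Lemma club_limits : club lt (is_limit lt).
Proof.
split=> [D DL //|x]; have [D [xD DL _]] := omega1_closure id x.
by exists D; split=> //; left.
Qed.

(** Fodor's lemma with an unbounded fibre. If each fibre over [a] were bounded by [g a], a point [D]
    of [S] in the club of limits closed under [g] would exceed [g (h D)], the bound for its own
    fibre. *)
Lemma pressing_down (S : W -> Prop) (h : W -> W) : stationary lt S ->
  (forall D, S D -> is_limit lt D -> h D < D) ->
  exists a, forall b, exists D, [/\ b < D, S D, is_limit lt D & h D = a].
Proof.
move=> statS hreg; apply: contrapT => no.
have /choice[g gP] : forall a, exists b, forall D, S D -> is_limit lt D -> h D = a -> D <= b.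
  move=> a; apply: contrapT => na; apply: no; exists a => b; apply: contrapT => nb.
  apply: na; exists b => D SD DL hD; rewrite leNgt; apply/negP => bD.
  by apply: nb; exists D.
have [|D [[DL Dg] SD]] := statS (fun D => is_limit lt D /\ forall b, b < D -> g b < D).
  split=> [D DL Dcof|x].
    split=> // b bD; have [_ /(_ b bD)[n [bn nD]]] := DL.
    have [c [[_ cg] [nc cD]]] := Dcof n nD; apply: lt_trans cD; apply: cg.
    by case: nc => [nc|<-//]; exact: lt_trans bn nc.
  by have [D [xD DL Dg]] := omega1_closure g x; exists D; split=> //; left.
have := gP (h D) D SD DL erefl; rewrite leNgt => /negP; apply.
by apply: Dg; exact: hreg.
Qed.

(** Take upper bounds [v n] of the first [n.+1] terms in an enumeration of the predecessors of [D]: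
    once [b] has been enumerated, no later [v j] is below [b]. *)
Lemma omega1_cofinal D : is_limit lt D -> exists N : set W,
  [/\ forall a, N a -> a < D, forall b, b < D -> exists2 a, N a & b < a &
      forall b, b < D -> finite_set (N `&` [set a | a < b])].
Proof.
move=> [[m mD] DL].
have [e [eD esurj]] := countable_enum (omega1_initial D) mD.
have /choice[v vP] : forall n, exists a, a < D /\ forall j, (j <= n)%N -> e j <= a.
  elim=> [|n [a [aD aP]]]; first by exists (e 0%N); split=> [|[|//]]; first exact: (eD 0%N).
  exists (Order.max a (e n.+1)); split; first by rewrite gt_max aD; exact: (eD n.+1).
  move=> j; rewrite leq_eqVlt => /orP[/eqP->|jn]; rewrite le_max ?lexx ?orbT//.
  by rewrite aP.
exists (range v); split=> [_ [n _ <-]|b bD|b bD]; first by case: (vP n).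
  have [c [bc cD]] := DL b bD; have [n nc] := esurj c cD.
  exists (v n); first by exists n.
  by apply: lt_le_trans bc _; rewrite -nc; case: (vP n) => _; exact.
have [n nb] := esurj b bD.
apply: sub_finite_set (finite_image v (finite_II n)) => _ [[j _ <-] /= jb].
exists j => //=; rewrite ltnNge; apply/negP => nj; move: jb; rewrite ltNge => /negP; apply.
by rewrite -nb; case: (vP j) => _; exact.
Qed.

(* Todorcevic's function rho_1 for the ladders given by enumerations [e b] of the
   predecessors of [b]: walk from [b] to the first [e b k >= a] and take the maximum of
   the indices [k] met on the way down to [a]. *)
Lemma coherent_finite_to_one : exists rho : W -> W -> nat,
  (forall b n, finite_set [set a | a < b /\ (rho a b <= n)%N]) /\
  (forall a b, a < b -> finite_set [set x | x < a /\ rho x a <> rho x b]).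
Proof.
have /choice[e eP] : forall b, exists e : nat -> W, (exists a, a < b) ->
    (forall n, e n < b) /\ (forall a, a < b -> exists n, e n = a).
  move=> b; have [[a ab]|no] := pselect (exists a, a < b); last by exists (fun=> b).
  by have [e eP] := countable_enum (omega1_initial b) ab; exists e.
pose k a b := if pselect (exists n, a <= e b n) is left ex then ex_minn ex else 0%N.
(* The inner test supplies the descent proof that [Fix] requires; it succeeds whenever [a < b]. *)
pose F a b (rec : forall c, lt c b -> nat) : nat :=
  if pselect (lt a b) is left _ then
    maxn (k a b) (if pselect (lt (e b (k a b)) b) is left p then rec _ p else 0%N)
  else 0%N.
pose rho a b := Fix omega1_wf (fun=> nat) (F a) b.
have rhoE a b : rho a b = F a b (fun c _ => rho a c).
  rewrite /rho Fix_eq// => c f g fg; rewrite /F; case: pselect => // _.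
  by case: pselect => // p; rewrite fg.
have kP a b : a < b -> [/\ a <= e b (k a b), e b (k a b) < b,
    forall n, a <= e b n -> (k a b <= n)%N & rho a b = maxn (k a b) (rho a (e b (k a b)))].
  move=> ab; have [eb esurj] := eP b (ex_intro _ a ab).
  have [ak kmin] : a <= e b (k a b) /\ forall n, a <= e b n -> (k a b <= n)%N.
    rewrite /k; case: pselect => [ex|[]]; first by case: ex_minnP.
    by have [n <-] := esurj a ab; exists n.
  split=> //; rewrite rhoE /F; case: pselect => // _.
  by case: pselect => // -[]; exact: eb.
have fin1 b n : finite_set [set a | a < b /\ (rho a b <= n)%N].
  elim/(well_founded_ind omega1_wf) : b n => b IH n.
  apply: (@sub_finite_set _ _ (\bigcup_(j in `I_n.+1)
    ([set a | e b j < b /\ a < e b j /\ (rho a (e b j) <= n)%N] `|` [set e b j]))).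
    move=> a [ab]; have [ak kb _ ->] := kP a b ab; rewrite geq_max => /andP[kn an].
    exists (k a b); rewrite //=; move: ak; rewrite le_eqVlt => /orP[/eqP|] ak.
      by right.
    by left.
  apply: bigcup_finite => [|j _]; first exact: finite_II.
  rewrite finite_setU; split; last exact: finite_set1.
  have [jb|njb] := pselect (e b j < b); last by apply: sub_finite_set (@finite_set0 _) => a [].
  by apply: sub_finite_set (IH _ jb n) => a [].
exists rho; split=> // a b; elim/(well_founded_ind omega1_wf) : b a => b IH a ab.
have [ak kb _ _] := kP a b ab.
(* For [x < a] the walk from [b] starts with an index [k x b <= k a b]. Apart from finitely many
   [x], [rho x a] exceeds [k a b] and equals [rho x (e b (k x b))] by induction, so the maximum
   absorbs [k x b]. *)
apply: (@sub_finite_set _ _ (\bigcup_(j in `I_(k a b).+1)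
    ([set x | [/\ e b j < b, x < a, x < e b j & rho x a <> rho x (e b j)]] `|` [set e b j])
    `|` [set x | x < a /\ (rho x a <= k a b)%N])).
  move=> x [xa ne]; apply: contrapT => /not_orP[nj nx]; apply: ne.
  have [xk xkb xmin ->] := kP x b (lt_trans xa ab).
  have kk : (k x b <= k a b)%N by apply: xmin; exact: le_trans (ltW xa) ak.
  have kx : (k a b < rho x a)%N by rewrite ltnNge; apply/negP => xk'; apply: nx.
  have E : rho x a = rho x (e b (k x b)).
    apply: contrapT => ne; apply: nj; exists (k x b) => //=.
    move: xk; rewrite le_eqVlt => /orP[/eqP|] xk; first by right.
    by left.
  by rewrite -E; apply/esym/maxn_idPr; exact: leq_trans kk (ltnW kx).
rewrite finite_setU; split; last exact: fin1.
apply: bigcup_finite => [|j _]; first exact: finite_II.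
rewrite finite_setU; split; last exact: finite_set1.
have [jb|njb] := pselect (e b j < b); last by apply: sub_finite_set (@finite_set0 _) => x [].
have [ja|aj|ja] := ltgtP (e b j) a.
- by apply: sub_finite_set (IH a ab _ ja) => x [_ _ xj ne]; split=> // /esym.
- by apply: sub_finite_set (IH _ jb _ aj) => x [].
- by apply: sub_finite_set (@finite_set0 _) => x [_ _ _]; rewrite ja.
Qed.
End OmegaOne.

(** * The completeness invariant and the cardinality *)

Lemma fraction_div (R : idomainType) (q : {fraction R}) :
  exists a b : R, b != 0 /\ q = a%:F / b%:F.
Proof.
elim/quotW: q => x; exists (\n_x), (\d_x); split; first exact: denom_ratioP.
have d0 : (\d_x)%:F != 0 :> {fraction R} by rewrite tofrac_eq0 denom_ratioP.
apply: (mulIf d0); rewrite divfK//.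
rewrite !piE; apply/eqmodP; rewrite /= FracField.equivfE /FracField.mulf.
by rewrite !numden_Ratio ?mulr1 ?oner_eq0 ?denom_ratioP// mulrC.
Qed.

Local Open Scope card_scope.

Lemma equipotent_inj (A B : Type) (f : A -> B) (g : B -> A) :
  injective f -> injective g -> equipotent A B.
Proof.
move=> finj ginj.
have leT U V (h : U -> V) : injective h -> [set: U] #<= [set: V].
  by move=> hinj; exact: (card_ge_preimage (B := setT) (in2W hinj)).
have [a|nA] := pselect (exists a : A, True); last first.
  exists f; exists g => x; first by case: nA; exists x.
  by case: nA; exists (g x).
have [a0 _] := a; elim/Ppointed: B => B in f g finj ginj *; first by have := no (f a0).
have /card_set_bijP[h] := Cantor_Bernstein (leT _ _ _ finj) (leT _ _ _ ginj).
by rewrite setTT_bijective; exists h.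
Qed.

Section Ring.
Context {d : Order.disp_t} {W : orderType d}.
Let lt := fun x y : W => is_true (x < y).
Hypothesis HW : is_omega1 lt.
Variables (K : fieldType) (S : W -> Prop).

(** The cut [None] forces the variables of each series to be bounded, which keeps the cardinality of
    the ring at aleph_1. *)
Definition cuts : set (option W) :=
  [set o | if o is Some D then S D /\ is_limit lt D else True].

Definition gamma_ring := hahn K cuts.
Local Notation R := gamma_ring.
Definition rX (n : W) : R := hterm cuts 1 (eX n).

Lemma gamma_tame (x : R) o u : cuts o -> below o u -> tame o x.
Proof. by have [_ _ tx] := hcP x => Co uo; apply: tx => //; exists u. Qed.

Lemma rX_neq0 n : rX n != 0. Proof. exact/hterm1_neq0/ltW/eX_gt0. Qed.

Lemma dvd_rX n (x : R) : dvdR (rX n) x <-> forall g, g < eX n -> x g = 0.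
Proof. exact/dvd_hterm/ltW/eX_gt0. Qed.

Lemma eX_le (m n : W) : m <= n -> eX m <= eX n.
Proof. by rewrite le_eqVlt => /orP[/eqP->//|/eX_lt/ltW]. Qed.

Definition rXB (m n : W) : R := hterm cuts 1 (eX n - eX m).

Lemma rX_rXB m n : m <= n -> rX n = rXB m n * rX m.
Proof.
by move=> mn; rewrite /rX /rXB hterm_mul ?mulr1 ?subrK// ?leBr0 ?eX_le// ltW// eX_gt0.
Qed.

Lemma rX_dvd m n : lt m n -> dvdR (rX m) (rX n).
Proof. by move=> mn; exists (rXB m n); exact/rX_rXB/ltW. Qed.

Lemma expo_le_eX (g : expo W) n : (forall t, n <= t -> g t = 0) -> g < eX n.
Proof.
move=> gn; apply/expo_ltP; exists n => [|s ns]; rewrite eXE gn ?lexx ?eqxx// 1?ltW//.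
by rewrite gt_eqF.
Qed.

(** The top nonzero coordinate of a nonnegative exponent is positive; above [n] it would make [g]
    larger than [eX n]. *)
Lemma expo_small_above (g : expo W) n t : 0 <= g -> g <= eX n -> n < t -> g t = 0.
Proof.
move=> g0 gn nt; have [->//|/eqP/expo_top[s gs gabove]] := eqVneq g 0.
have [ns|sn] := ltP n s; last by rewrite gabove// (le_lt_trans sn).
move: gn; rewrite leNgt => /negP[]; apply/expo_ltP; exists s => [|u su].
  rewrite eXE gt_eqF// lt_neqAle eq_sym gs leNgt; apply/negP => gs0.
  by move: g0; rewrite leNgt => /negP; apply; apply/expo_ltP; exists s.
by rewrite eXE gt_eqF ?(lt_trans ns)// gabove.
Qed.

Lemma finite_bounded (A : set W) : finite_set A -> exists b, forall a, A a -> a < b.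
Proof. by move=> /finite_set_countable /(omega1_bounded HW). Qed.

Lemma expo_lt_eX_ex (g : expo W) : exists n, g < eX n.
Proof.
have [n nP] := finite_bounded (efP g); exists n; apply: expo_le_eX => t nt.
by apply: contrapT => /eqP /nP; rewrite ltNge nt.
Qed.

Lemma dvd_rX_ex (x : R) : x != 0 -> exists n, dvdR x (rX n).
Proof.
move=> /hahn_factor[g [c [g0 cu ->]]]; have [n gn] := expo_lt_eX_ex g.
exists n, (c^-1 * hterm cuts 1 (eX n - g)).
rewrite mulrACA mulVr// mul1r hterm_mul ?mulr1 ?subrK// leBr0; exact: ltW.
Qed.

Lemma rX_cofinal (q : {fraction R}) : exists n, inR ((rX n)%:F * q).
Proof.
have [a [b [b0 ->]]] := fraction_div q; have [n [c rn]] := dvd_rX_ex b0.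
exists n, (c * a); rewrite rn !tofracM mulrACA mulrA -mulrA divff ?tofrac_eq0//.
by rewrite mulr1.
Qed.

Lemma limit_max D (m n : W) : is_limit lt D -> m < D -> n < D ->
  exists2 k, k < D & m < k /\ n < k.
Proof.
move=> [_ DL] mD nD; have mnD : lt (Order.max m n) D by rewrite /lt gt_max mD.
have [k [mk kD]] := DL _ mnD.
by exists k => //; move: mk; rewrite /lt gt_max => /andP[].
Qed.

(* The partial sums of the [eX t], for [t] in a cofinal set of order type omega, have no
   tame limit. *)
Lemma gamma_not_complete D : is_limit lt D -> S D -> ~ complete_at lt rX D.
Proof.
move=> DL SD complD; have [N [ND Ncof Nfin]] := omega1_cofinal HW DL.
pose xv n g : K := if `[< exists2 t, N t /\ t < n & g = eX t >] then 1 else 0.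
have /choice[x xP] : forall n, exists x : R, n < D -> forall g, x g = xv n g.
  move=> n; have [nD|nD] := pselect (n < D); last by exists 0 => /nD.
  have xgood : hgood cuts (xv n).
    apply: hgood_finite => [|g]; rewrite /supp /xv /=.
      apply: sub_finite_set (finite_image (@eX _ W) (Nfin n nD)) => g /=.
      by case: asboolP => [[t [Nt tn] ->] _|]; [exists t|rewrite eqxx].
    by case: asboolP => [[t _ ->] _|]; rewrite ?eqxx// ltW// eX_gt0.
  by exists (Hahn xgood).
have [m n mn nD|y yP] := complD x.
  apply/dvd_rX => g gm; rewrite hahnBE !xP//; last exact: lt_trans nD.
  apply/eqP; rewrite subr_eq0 /xv; apply/eqP; congr (if _ then _ else _).
  apply/asbool_equiv_eq; split=> -[t [Nt tn] gt]; exists t => //; split=> //.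
    exact: lt_trans mn.
  rewrite ltNge; apply/negP => /eX_le; rewrite leNgt => /negP; apply.
  by rewrite -gt.
have [[m mD] _] := DL.
(* In a limit [y], the coefficient at [0] over the variables below [D] would be bounded by some
   [u < D], yet [y] contains [eX t] for some [t] in [N] above [u]. *)
have [u uD uP] := gamma_tame y (conj SD DL : cuts (Some D)) mD 0; have [t Nt ut] := Ncof u uD.
have tD := ND t Nt; have [_ /(_ t tD)[n [tn nD]]] := DL.
have yt : y (eX t) = 1.
  have := (dvd_rX _ _).1 (yP n nD) (eX t) (eX_lt tn).
  rewrite hahnBE xP// /xv; case: asboolP => [_ /eqP|[]]; last by exists t.
  by rewrite subr_eq0 => /eqP.
have := uP (eX t); rewrite yt oner_eq0 => /(_ isT)/(_ _ t ut).
rewrite eXE eqxx => /(_ _)/eqP; rewrite expo0E => F; have : false; last by [].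
apply: F => s sD; rewrite eXE; case: (s =P t) => // st.
by rewrite st /= tD in sD.
Qed.

(** The coefficients of a Cauchy family stabilise to a formal limit [yv], whose variables lie below
    [D], so it is tame at cuts above [D]. A cut in [S] differs from [D], and at a cut below [D] each
    coefficient of [yv] is contained in that of a single [x n]. *)
Lemma gamma_complete D : is_limit lt D -> ~ S D -> complete_at lt rX D.
Proof.
move=> DL nSD x xcoh.
pose yv g : K :=
  if pselect (exists n, n < D /\ g < eX n) is left e then x (projT1 (cid e)) g else 0.
have yE n g : n < D -> g < eX n -> yv g = x n g.
  move=> nD gn; rewrite /yv; case: pselect => [e|[]]; last by exists n.
  case: cid => m [mD gm] /=; apply/eqP; rewrite -subr_eq0; apply/eqP.
  have [mn|nm|->] := ltgtP m n; last by rewrite subrr.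
    exact: ((dvd_rX _ _).1 (xcoh m n mn nD)).
  by rewrite -opprB ((dvd_rX _ _).1 (xcoh n m nm mD) g gn : x n g - x m g = 0) oppr0.
have yN g : yv g != 0 -> exists n, n < D /\ g < eX n.
  by rewrite /yv; case: pselect => // _; rewrite eqxx.
have y0 g : yv g != 0 -> 0 <= g.
  by move=> yg; have [n [nD gn]] := yN g yg; rewrite (yE n) in yg => //; exact: hahn_ge0 yg.
have yD g : yv g != 0 -> exists2 n, n < D & forall t, n < t -> g t = 0.
  move=> yg; have [n [nD gn]] := yN g yg; exists n => // t.
  by apply: expo_small_above (ltW gn); exact: y0.
have ygood : hgood cuts yv.
  split=> // [P PY [p Pp]|o Co [u0 u0o] g].
    have [n [nD pn]] := yN p (PY p Pp).
    have wx : wo (supp (x n)) by exact: wo_hahn.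
    have [||m [Pm mp] mmin] := wx (P `&` [set g | g <= p]).
    - by move=> g [Pg gp]; rewrite /supp /= -yE//; [exact: PY|exact: le_lt_trans pn].
    - by exists p; split=> //=.
    exists m => // h Ph; have [hp|/ltW ph] := leP h p; first exact: mmin.
    exact: le_trans mp ph.
  have [[h yh hg]|no] := pselect (exists2 h, yv h != 0 & eqout o h g); last first.
    by exists u0 => // h yh hg; case: no; exists h.
  have [n0 n0D hn0] := yD h yh.
  have [Do|] := pselect (below o D).
    have og : eqout o 0 g.
      move=> t nt; rewrite -(hg t nt) expo0E hn0//; apply: lt_trans n0D _.
      by rewrite ltNge; apply/negP => tD; move: nt; rewrite (below_le tD).
    have [u uo uP] := eqout_eqabove u0o og.
    exists (Order.max u D) => [|g' yg' gg' t]; first by case: leP.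
    rewrite gt_max => /andP[ut Dt]; rewrite -uP// expo0E.
    by have [n nD ->//] := yD g' yg'; exact: lt_trans Dt.
  case: o Co u0o hg => [D'|//] /= [SD' D'L] u0D' hg D'D.
  have {}D'D : D' < D.
    move: D'D => /negP; rewrite -leNgt le_eqVlt => /orP[/eqP E|//].
    by rewrite E in SD'.
  (* With [n] above [D'] and above the variables of [h], every exponent in this coefficient is less
     than [eX n], so [yv] can be replaced by [x n]. *)
  have [n nD [n0n D'n]] := limit_max DL n0D D'D.
  have [u uo uP] := gamma_tame (x n) (conj SD' D'L : cuts (Some D')) u0D' g; exists u => // g' yg' gg'; apply: uP => //.
  rewrite -yE//; apply: expo_le_eX => t nt.
  have tD' : ~~ (t < D') by rewrite -leNgt (le_trans (ltW D'n)).
  by rewrite (gg' t tD') -(hg t tD') hn0// (lt_le_trans n0n).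
exists (Hahn ygood) => n nD; apply/dvd_rX => g gn.
by rewrite hahnBE /= (yE n) ?subrr.
Qed.

Lemma gamma_equiv : club_equiv lt (GammaQR_set lt rX) S.
Proof.
exists (is_limit lt); split; first exact: club_limits HW.
move=> D DL; split=> [[_ nc]|SD]; last by split=> //; exact: gamma_not_complete.
by apply: contrapT => nSD; apply: nc; exact: gamma_complete.
Qed.

(** The variables of a series lie in a countable segment. An enumeration [a x] of it lets natural
    numbers code the exponents, so the series is determined by [a x] and a sequence in [K]. As [W]
    and [K] are equipotent with [nat -> bool], both sequences fit into one element of [W].
    Conversely, the constants embed [K]. *)
Lemma gamma_card : equipotent (nat -> bool) W -> equipotent K W -> equipotent R W.
Proof.
move=> [f [f' ff' f'f]] [k [k' kk' k'k]].
have /choice[a aP] : forall x : R, exists a : nat -> W,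
    forall g t, x g != 0 -> g t != 0 -> exists n, a n = t.
  move=> x; have [u _ uP] := gamma_tame x (I : cuts None) (isT : below None (f xpredT)) 0.
  have [v uv] := omega1_succ HW u.
  have [a [aD asurj]] := countable_enum (omega1_initial HW v) (uv : [set y | y < v] u).
  exists a => g t xg gt; apply: asurj; apply: le_lt_trans uv; rewrite leNgt; apply/negP => ut.
  by move: gt; rewrite (uP g) ?expo0E ?eqxx.
(* An exponent is listed as pairs of a position in the enumeration and the value there; positions
   not listed have value [0]. *)
pose dec (b : nat -> W) (z : seq (nat * int)) t : int :=
  if [seq p <- z | b p.1 == t] is p :: _ then p.2 else 0.
pose codes (b : nat -> W) (m : nat) (g : expo W) :=
  exists2 z : seq (nat * int), choice.unpickle m = Some z & forall t, g t = dec b z t.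
have codes_uniq b m g h : codes b m g -> codes b m h -> g = h.
  by move=> [z zm gz] [z' zm' hz]; apply: expoP => t; move: zm zm' gz hz => -> [->] -> ->.
have codes_ex (x : R) g : x g != 0 -> exists m, codes (a x) m g.
  move=> xg; have /finite_seqP[s sE] := efP g.
  have /choice[j jP] : forall t, exists n, g t != 0 -> a x n = t.
    by move=> t; have [gt|] := boolP (g t != 0);
      [have [n <-] := aP x g t xg gt; exists n|exists 0%N].
  exists (choice.pickle [seq (j t, g t) | t <- s]); eexists; first by rewrite choice.pickleK.
  have sP t : (t \in s) = (g t != 0).
    by apply/idP/idP => [ts|gt]; [have : [set` s] t by []|
      have : [set t | g t != 0] t by []]; rewrite ?sE// -sE.
  move=> t; rewrite /dec; case E: [seq p <- _ | _] => [|p r].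
    apply: contrapT => /eqP gt; have : (j t, g t) \in [seq p <- [seq (j t, g t) | t <- s] | a x p.1 == t].
      by rewrite mem_filter /= jP// eqxx; apply/mapP; exists t; rewrite ?sP.
    by rewrite E.
  have : p \in [seq p <- [seq (j t, g t) | t <- s] | a x p.1 == t] by rewrite E mem_head.
  rewrite mem_filter => /andP[/eqP pt /mapP[t' t's pE]].
  by move: pt; rewrite pE /= jP -?sP// => ->.
pose c (x : R) m : K :=
  if pselect (exists g, codes (a x) m g) is left e then x (projT1 (cid e)) else 0.
pose code (x : R) : nat * nat * bool -> bool := fun p =>
  if p.2 then f' (a x p.1.1) p.1.2 else f' (k (c x p.1.1)) p.1.2.
pose F (x : R) : W := f (fun n => if choice.unpickle n is Some p then code x p else false).
have Finj : injective F.
  move=> x y /(can_inj ff') E0; have E p : code x p = code y p.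
    by have := congr1 (fun h : nat -> bool => h (choice.pickle p)) E0; rewrite /= !choice.pickleK.
  have Ea : a x = a y.
    apply/funext => n; apply: (can_inj f'f); apply/funext => m.
    exact: (E (n, m, true)).
  have Ec m : c x m = c y m.
    apply: (can_inj kk'); apply: (can_inj f'f); apply/funext => n.
    exact: (E (m, n, false)).
  have cE (z : R) m g : codes (a z) m g -> c z m = z g.
    move=> zg; rewrite /c; case: pselect => [e|[]]; last by exists g.
    by case: cid => h /= zh; rewrite (codes_uniq _ _ _ _ zg zh).
  apply: hahnP => g; have [xg|xg] := eqVneq (x g) 0.
    have [->//|yg] := eqVneq (y g) 0.
    by have [m my] := codes_ex y g yg; rewrite -(cE y m g my) -Ec (cE x m g)// Ea.
  by have [m mx] := codes_ex x g xg; rewrite -(cE x m g mx) Ec (cE y m g)// -Ea.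
apply: (@equipotent_inj _ _ F (fun w => hterm cuts (k' w) 0)) => //.
move=> v w /(congr1 (fun x : R => x 0)); rewrite !htermE// eqxx.
exact: (can_inj k'k).
Qed.
End Ring.

(** * Subquotients of modules *)

Section Subquotient.
Variables (R : idomainType) (V : lmodType R) (A N : V -> Prop).
Hypotheses (subA : submod A) (subN : submod N).

Lemma submodN (P : V -> Prop) x : submod P -> P x -> P (- x).
Proof. by move=> [_ _ PZ] Px; rewrite -scaleN1r; exact: PZ. Qed.

Lemma submodB (P : V -> Prop) x y : submod P -> P x -> P y -> P (x - y).
Proof. by move=> PS Px Py; have [_ PD _] := PS; apply: PD => //; exact: submodN. Qed.

Definition coset x : set V := [set y | N (y - x)].

Lemma cosetP x y : coset x = coset y <-> N (x - y).
Proof.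
have [N0 ND NZ] := subN; split=> [E|xy].
  have : coset x x by rewrite /coset /= subrr.
  by rewrite E.
apply/seteqP; split=> z /= zx; rewrite /coset /=.
  by rewrite -(subrK x z) -addrA; exact: ND.
by rewrite -(subrK y z) -addrA; apply: ND => //; rewrite -opprB; exact: submodN.
Qed.

Record subquot_set := Subquot { sqset :> set V; sqP : exists2 x, A x & sqset = coset x }.

HB.instance Definition _ := gen_eqMixin subquot_set.
HB.instance Definition _ := gen_choiceMixin subquot_set.

Lemma subquot_inj (u v : subquot_set) : sqset u = sqset v -> u = v.
Proof.
case: u v => [u uP] [v vP] /= E; case: _ / E vP => vP.
by congr Subquot; exact: Prop_irrelevance.
Qed.

Definition sqrepr (u : subquot_set) : V := projT1 (cid2 (sqP u)).
Lemma sqreprA u : A (sqrepr u). Proof. by rewrite /sqrepr; case: cid2. Qed.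
Lemma sqreprE u : sqset u = coset (sqrepr u). Proof. by rewrite /sqrepr; case: cid2. Qed.
#[local] Hint Resolve sqreprA : core.

Definition sqpi (x : V) (Ax : A x) : subquot_set := Subquot (ex_intro2 _ _ x Ax erefl).

Lemma sqpiP x y (Ax : A x) (Ay : A y) : sqpi Ax = sqpi Ay <-> N (x - y).
Proof.
split=> [/(congr1 sqset)/cosetP//|xy].
by apply: subquot_inj; exact/cosetP.
Qed.

Lemma sqpiK u : sqpi (sqreprA u) = u.
Proof. by apply: subquot_inj; rewrite [RHS]sqreprE. Qed.

Lemma sqrepr_pi x (Ax : A x) : N (sqrepr (sqpi Ax) - x).
Proof. by apply/cosetP; rewrite -sqreprE. Qed.

Fact subA0 : A 0. Proof. by case: subA. Qed.
Fact subAD x y : A x -> A y -> A (x + y). Proof. by case: subA => _ + _; exact. Qed.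
Fact subAZ (r : R) x : A x -> A (r *: x). Proof. by case: subA => _ _; exact. Qed.
Fact subNN x : A x -> A (- x). Proof. exact: submodN. Qed.

Definition sqadd u v := sqpi (subAD (sqreprA u) (sqreprA v)).
Definition sqopp u := sqpi (subNN (sqreprA u)).
Definition sqscale r u := sqpi (subAZ r (sqreprA u)).

Lemma sqaddE x y (Ax : A x) (Ay : A y) : sqadd (sqpi Ax) (sqpi Ay) = sqpi (subAD Ax Ay).
Proof.
have [_ ND _] := subN; apply/sqpiP; rewrite opprD addrACA.
by apply: ND; exact: sqrepr_pi.
Qed.

Lemma sqscaleE r x (Ax : A x) : sqscale r (sqpi Ax) = sqpi (subAZ r Ax).
Proof. by have [_ _ NZ] := subN; apply/sqpiP; rewrite -scalerBr; apply: NZ; exact: sqrepr_pi. Qed.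

Lemma sqind (P : subquot_set -> Prop) : (forall x (Ax : A x), P (sqpi Ax)) -> forall u, P u.
Proof. by move=> H u; rewrite -(sqpiK u). Qed.

Lemma sqpi_eq x y (Ax : A x) (Ay : A y) : x = y -> sqpi Ax = sqpi Ay.
Proof. by move=> E; apply/sqpiP; rewrite E subrr; case: subN. Qed.

Fact sqaddA : associative sqadd.
Proof.
elim/sqind => x Ax; elim/sqind => y Ay; elim/sqind => z Az.
by rewrite !sqaddE; apply: sqpi_eq; rewrite addrA.
Qed.
Fact sqaddC : commutative sqadd.
Proof.
elim/sqind => x Ax; elim/sqind => y Ay.
by rewrite !sqaddE; apply: sqpi_eq; rewrite addrC.
Qed.
Fact sqadd0 : left_id (sqpi subA0) sqadd.
Proof. by elim/sqind => x Ax; rewrite sqaddE; apply: sqpi_eq; rewrite add0r. Qed.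
Fact sqaddN : left_inverse (sqpi subA0) sqopp sqadd.
Proof.
elim/sqind => x Ax; rewrite /sqopp sqaddE; apply/sqpiP; rewrite subr0 addrC.
by rewrite -opprB; apply: submodN => //; exact: sqrepr_pi.
Qed.
(* The module laws need both proofs, so the carrier mentions them for the sake of
   instance inference. *)
Definition subquot (_ : submod A) (_ : submod N) : Type := subquot_set.
HB.instance Definition _ := Choice.on (subquot subA subN).
HB.instance Definition _ := GRing.isZmodule.Build (subquot subA subN) sqaddA sqaddC sqadd0 sqaddN.

Fact sqscaleA r s u : sqscale r (sqscale s u) = sqscale (r * s) u.
Proof. by elim/sqind: u => x Ax; rewrite !sqscaleE; apply: sqpi_eq; rewrite scalerA. Qed.
Fact sqscale1 : left_id 1 sqscale.
Proof. by elim/sqind => x Ax; rewrite sqscaleE; apply: sqpi_eq; rewrite scale1r. Qed.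
Fact sqscaleDr : right_distributive sqscale (+%R : subquot subA subN -> _).
Proof.
move=> r; elim/sqind => x Ax; elim/sqind => y Ay.
by rewrite -[_ + _]/(sqadd _ _) -[X in _ = X]/(sqadd _ _) !(sqaddE, sqscaleE);
  apply: sqpi_eq; rewrite scalerDr.
Qed.
Fact sqscaleDl (u : subquot subA subN) :
  {morph (sqscale^~ u : R -> subquot subA subN) : r s / r + s}.
Proof.
elim/sqind: u => x Ax r s; rewrite -[X in _ = X]/(sqadd _ _) !(sqaddE, sqscaleE).
by apply: sqpi_eq; rewrite scalerDl.
Qed.
HB.instance Definition _ := GRing.Zmodule_isLmodule.Build R (subquot subA subN)
  sqscaleA sqscale1 sqscaleDr sqscaleDl.
End Subquotient.

(** The quotient of [A] by its intersection with [N], presented by a map [q] that is defined on all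
    of [V] but meaningful only on [A]. *)
Lemma subquotient (R : idomainType) (V : lmodType R) (A N : V -> Prop) :
  submod A -> submod N -> exists (M : lmodType R) (q : V -> M),
  [/\ forall (r : R) x y, A x -> A y -> q (r *: x + y) = r *: q x + q y,
      forall x, A x -> (q x = 0 <-> N x) & forall u, exists2 x, A x & q x = u].
Proof.
move=> subA subN.
pose q x : subquot subA subN :=
  if pselect (A x) is left Ax then sqpi N Ax else sqpi N (subA0 subA).
have qE x (Ax : A x) : q x = sqpi N Ax.
  by rewrite /q; case: pselect => // Ax'; congr sqpi; exact: Prop_irrelevance.
have [A0 AD AZ] := subA.
exists (subquot subA subN), q; split=> [r x y Ax Ay|x Ax|u].
- rewrite (qE _ Ax) (qE _ Ay) (qE _ (AD _ _ (AZ r _ Ax) Ay)).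
  rewrite -[RHS]/(sqadd subA (sqscale subA r (sqpi N Ax)) (sqpi N Ay)).
  by rewrite (sqscaleE subA subN) (sqaddE subA subN); exact: sqpi_eq.
- rewrite (qE _ Ax) -[X in _ = X]/(sqpi N (subA0 subA)).
  by rewrite (sqpiP subN) subr0.
- by exists (sqrepr u); rewrite ?(qE _ (sqreprA u)) ?sqpiK//; exact: sqreprA.
Qed.

(** * Uniserial modules from coherent systems of units *)

Section Divisibility.
Variable R : idomainType.
Implicit Types (a b c : R).

Lemma dvdR0 a : dvdR a 0. Proof. by exists 0; rewrite mul0r. Qed.
Lemma dvdRD a b c : dvdR a b -> dvdR a c -> dvdR a (b + c).
Proof. by move=> [x ->] [y ->]; exists (x + y); rewrite mulrDl. Qed.
Lemma dvdRMl a b c : dvdR a b -> dvdR a (c * b).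
Proof. by move=> [x ->]; exists (c * x); rewrite mulrA. Qed.
Lemma dvdRM2 a b c : dvdR a b -> dvdR (c * a) (c * b).
Proof. by move=> [x ->]; exists x; rewrite mulrCA. Qed.
Lemma dvdRM2_cancel a b c : c != 0 -> dvdR (c * a) (c * b) -> dvdR a b.
Proof. by move=> c0 [x E]; exists x; apply: (mulfI c0); rewrite E mulrCA. Qed.
Lemma dvdR_unitr a b u : u \is a GRing.unit -> dvdR a (b * u) -> dvdR a b.
Proof. by move=> uu [x E]; exists (x / u); rewrite mulrAC -E mulrK. Qed.

Lemma fraction_comparable (p q : {fraction R}) : valuation_domain R ->
  (exists s : R, q = s%:F * p) \/ (exists s : R, p = s%:F * q).
Proof.
move=> vR; have [a [b [b0 ->]]] := fraction_div p; have [c [e [e0 ->]]] := fraction_div q.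
have tofb : b%:F != 0 :> {fraction R} by rewrite tofrac_eq0.
have tofe : e%:F != 0 :> {fraction R} by rewrite tofrac_eq0.
have [[s E]|[s E]] := vR (a * e) (c * b); [left|right]; exists s.
  by apply/eqP; rewrite mulrA eqr_div// -!tofracM E mulrA.
by apply/eqP; rewrite mulrA eqr_div// -!tofracM E mulrA.
Qed.
End Divisibility.

Section GermModule.
Context {d : Order.disp_t} {W : orderType d}.
Variables (R : idomainType) (r : W -> R) (rB e : W -> W -> R).
Hypotheses (vR : valuation_domain R) (r0 : forall n, r n != 0)
  (rBP : forall m n, m <= n -> r n = rB m n * r m)
  (rN1 : forall n, ~ dvdR (r n) 1)
  (rcof : forall x : R, x != 0 -> exists n, dvdR x (r n))
  (eU : forall n m, e n m \is a GRing.unit)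
  (ecoh : forall n m p, n <= m -> m <= p -> dvdR (r n) (e n p - e n m * e m p)).

Lemma rB_trans m n p : m <= n -> n <= p -> rB m p = rB n p * rB m n.
Proof.
move=> mn np; apply: (mulIf (r0 m)).
by rewrite -mulrA -!rBP// (le_trans mn).
Qed.

(* The direct limit of the [R / r n] along multiplication by [rB n m * e n m], realised
   as germs at infinity of functions [f], modulo [r m] dividing [f m] eventually. *)
Lemma germ_module : exists (M : lmodType R) (al : W -> M),
  [/\ forall n m, n <= m -> al n = (rB n m * e n m) *: al m,
      forall n x, x *: al n = 0 <-> dvdR (r n) x &
      forall u, exists n x, u = x *: al n].
Proof.
pose V : lmodType R := (W -> R^o)%type.
(* The germ of the generator of [R / r n]: its image at stage [m] is [rB n m * e n m], and the value
   [0] before [n] does not affect the germ. *)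
pose a n : V := fun m => if n <= m then rB n m * e n m else 0.
pose N (f : V) := exists b, forall m, b <= m -> dvdR (r m) (f m).
pose A (f : V) := exists n x, N (f - x *: a n).
have [w0 _] := rcof (oner_neq0 R).
have subN : submod N.
  split=> [|f g [b fb] [c gc]|x f [b fb]].
  - by exists w0 => m _; exact: dvdR0.
  - exists (Order.max b c) => m; rewrite ge_max => /andP[bm cm].
    by apply: dvdRD; [exact: fb|exact: gc].
  - by exists b => m /fb; exact: dvdRMl.
have [N0 ND NZ] := subN.
have step n m : n <= m -> N (a n - (rB n m * e n m) *: a m).
  move=> nm; exists m => p mp.
  have -> : (a n - (rB n m * e n m) *: a m) p = a n p - (rB n m * e n m) * a m p by [].
  rewrite /a mp (le_trans nm mp) (rB_trans nm mp).
  (* The cocycle relation modulo [r n], multiplied by [rB n p], holds modulo [r p]. *)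
  have -> : rB m p * rB n m * e n p - rB n m * e n m * (rB m p * e m p) =
    rB n p * (e n p - e n m * e m p) by rewrite (rB_trans nm mp); ring.
  by rewrite (rBP (le_trans nm mp)); apply: dvdRM2; exact: ecoh.
have idx f n m x : N (f - x *: a n) -> n <= m -> N (f - (x * (rB n m * e n m)) *: a m).
  move=> fN nm; rewrite -scalerA.
  have -> : f - x *: ((rB n m * e n m) *: a m) =
      (f - x *: a n) + x *: (a n - (rB n m * e n m) *: a m).
    by rewrite scalerBr addrA subrK.
  by apply: ND => //; apply: NZ; exact: step.
have subA : submod A.
  split=> [|f g [n [x fx]] [m [y gy]]|x f [n [y fy]]].
  - by exists w0, 0; rewrite scale0r subr0.
  - have nk : n <= Order.max n m by rewrite le_max lexx.
    have mk : m <= Order.max n m by rewrite le_max lexx orbT.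
    exists (Order.max n m); eexists; have := ND _ _ (idx _ _ _ _ fx nk) (idx _ _ _ _ gy mk).
    by rewrite addrACA -opprD -scalerDl; exact.
  - by exists n, (x * y); rewrite -scalerA -scalerBr; exact: NZ.
have [M [q [qlin qker qsurj]]] := subquotient subA subN.
have [A0 AD AZ] := subA.
have Aa n : A (a n) by exists n, 1; rewrite scale1r subrr.
have q0 : q 0 = 0 by apply/qker.
have qZ x f : A f -> q (x *: f) = x *: q f.
  by move=> Af; have := qlin x f 0 Af A0; rewrite q0 !addr0.
have qB f g : A f -> A g -> N (f - g) -> q f = q g.
  move=> Af Ag fg; have := qlin 1 (f - g) g; rewrite scale1r subrK => ->//.
    by rewrite (qker _ _).2 ?scaler0 ?add0r//; exact: submodB.
  exact: submodB.
exists M, (fun n => q (a n)); split=> [n m nm|n x|u].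
- by rewrite -qZ//; apply: qB => //; [exact: AZ|exact: step].
- rewrite -qZ// qker; last exact: AZ.
  have ax m : n <= m -> (x *: a n) m = rB n m * (x * e n m).
    by move=> nm; rewrite -[LHS]/(x * a n m) /a nm mulrCA.
  split=> [[b bP]|xn].
    have bm : b <= Order.max b n by rewrite le_max lexx.
    have nm : n <= Order.max b n by rewrite le_max lexx orbT.
    have := bP _ bm; rewrite ax// {1}(rBP nm).
    move/dvdRM2_cancel => H; apply: (dvdR_unitr (eU n (Order.max b n))); apply: H.
    by apply: contra_neq (r0 (Order.max b n)) => E; rewrite (rBP nm) E mul0r.
  exists n => m nm; rewrite ax// (rBP nm); apply: dvdRM2.
  by rewrite mulrC; exact: dvdRMl.
- have [f Af <-] := qsurj u; have [n [x fx]] := Af; exists n, x.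
  by rewrite -qZ//; apply: qB => //; exact: AZ.
Qed.

Variables (M : lmodType R) (al : W -> M).
Hypotheses (alE : forall n m, n <= m -> al n = (rB n m * e n m) *: al m)
  (al0 : forall n x, x *: al n = 0 <-> dvdR (r n) x)
  (algen : forall u, exists n x, u = x *: al n).

Lemma al_common (u v : M) : exists n x y, u = x *: al n /\ v = y *: al n.
Proof.
have [n [x ->]] := algen u; have [m [y ->]] := algen v.
have nk : n <= Order.max n m by rewrite le_max lexx.
have mk : m <= Order.max n m by rewrite le_max lexx orbT.
by exists (Order.max n m); do 2 eexists; rewrite (alE nk) (alE mk) !scalerA.
Qed.

(** Any two elements are multiples of a common [al n], and the valuation makes the two multipliers
    comparable. *)
Lemma germ_uniserial : uniserial M.
Proof.
move=> P1 P2 [_ _ P1Z] [_ _ P2Z].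
have [[u [P1u P2u]]|no] := pselect (exists u, P1 u /\ ~ P2 u); [right|left] => v Pv.
  have [n [x [y [ux vy]]]] := al_common u v.
  have [[c yE]|[c xE]] := vR x y.
    by rewrite vy yE -scalerA -ux; exact: P1Z.
  by case: P2u; rewrite ux xE -scalerA -vy; exact: P2Z.
by apply: contrapT => nP; apply: no; exists v.
Qed.

(** Here [Ann (al n) = r n R] and [D (al n) = Q], and multiplication by [r n] carries [Q / R] to
    [Q / r n R]. *)
Lemma germ_type : has_type_QR M.
Proof.
have [n _] := rcof (oner_neq0 R); exists (al n); split.
  by apply/eqP => E; case: (@rN1 n); apply/al0; rewrite scale1r.
have rF0 : (r n)%:F != 0 :> {fraction R} by rewrite tofrac_eq0.
have Ann0 : AnnQ (al n) 0 by exists 0; rewrite tofrac0 scale0r.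
exists (fun x => (r n)%:F * x); split=> [x _|s x y _ _|x _|y _].
- have [p [t [t0 E]]] := fraction_div ((r n)%:F * x); rewrite E.
  exists t; split=> //; split; last by exists p.
  (* Since [t * r n] divides [r m], the transition factor from [n] to a late stage is a multiple of
     [t], so [t] divides [al n]. *)
  have [m [c cE]] := rcof (mulf_neq0 t0 (r0 n)).
  have nk : n <= Order.max n m by rewrite le_max lexx.
  have mk : m <= Order.max n m by rewrite le_max lexx orbT.
  set k := Order.max n m in nk mk.
  have rBt : rB n k = t * (rB m k * c).
    apply: (mulIf (r0 n)); rewrite -(rBP nk) (rBP mk) cE; ring.
  exists ((rB m k * c * e n k) *: al k).
  by rewrite scalerA (alE nk) rBt !mulrA.
- by have -> : (r n)%:F * (s%:F * x + y) - (s%:F * ((r n)%:F * x) + (r n)%:F * y) = 0 by ring.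
- split=> [[s [E /al0[c sE]]]|[s ->]].
    exists c; apply: (mulfI rF0); rewrite E sE tofracM mulrC//.
  exists (r n * s); rewrite tofracM; split=> //; apply/al0.
  by exists s; rewrite mulrC.
- by exists (y / (r n)%:F); split=> //; rewrite mulrC divfK// subrr.
Qed.

(* If [x n] in [J] represents [al n], then [A] is generated by [r n * x n] for every
   [n], so these generators differ by units. *)
Lemma standard_units : standard M -> exists c : W -> R,
  (forall n, c n \is a GRing.unit) /\
  (forall n m, n <= m -> dvdR (r n) (c n - e n m * c m)).
Proof.
move=> [A [J [[A0 AD AZ] [J0 JD JZ] AJ [f [flin fker fsurj]]]]].
have f0 : f 0 = 0.
  have := flin 1 0 0 J0 J0; rewrite mulr0 addr0 scale1r => /eqP.
  by rewrite -subr_eq subrr eq_sym => /eqP.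
have fZ s x : J x -> f (s%:F * x) = s *: f x.
  by move=> Jx; have := flin s x 0 Jx J0; rewrite f0 !addr0.
have /choice[x xP] : forall n, exists x, J x /\ f x = al n by move=> n; exact: fsurj.
have Jx n : J (x n) by case: (xP n).
have fx n : f (x n) = al n by case: (xP n).
have sxA n s : A (s%:F * x n) <-> dvdR (r n) s.
  by rewrite -al0 -fx -fZ//; split=> /fker; apply; exact: JZ.
have xnA n : ~ A (x n).
  by move=> xA; case: (@rN1 n); apply/sxA; rewrite tofrac1 mul1r.
have Asub n z : A z -> exists t, z = t%:F * ((r n)%:F * x n).
  move=> Az; have [[s zE]|[s xE]] := fraction_comparable (x n) z vR.
    have [t tE] : dvdR (r n) s by apply/sxA; rewrite -zE.
    by exists t; rewrite zE tE tofracM mulrA.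
  by case: (xnA n); rewrite xE; exact: AZ.
have rxA n : A ((r n)%:F * x n) by apply/sxA; exists 1; rewrite mul1r.
have [n0 _] := rcof (oner_neq0 R); set pi := (r n0)%:F * x n0.
have x0 n : x n != 0 by apply/eqP => E; apply: (xnA n); rewrite E.
have pi0 : pi != 0 by rewrite mulf_neq0 ?tofrac_eq0.
have /choice[c cP] : forall n, exists c, c \is a GRing.unit /\ (r n)%:F * x n = c%:F * pi.
  move=> n; have [c cE] := Asub n0 _ (rxA n); have [s sE] := Asub n _ (rxA n0).
  exists c; split=> //; apply/unitrPr; exists s; apply/eqP; rewrite -tofrac_eq.
  by apply/eqP/(mulIf pi0); rewrite tofracM tofrac1 mul1r mulrAC -cE mulrC -sE.
exists c; split=> [n|n m nm]; first by case: (cP n).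
(* Both terms have the same image under [f], so the difference lies in [A] and is a multiple of
   [pi]. Multiplied by [r n], it becomes [(c n - e n m * c m)%:F * pi]. *)
have zA : A (x n - (rB n m * e n m)%:F * x m).
  have E : x n - (rB n m * e n m)%:F * x m = (- (rB n m * e n m))%:F * x m + x n.
    by rewrite rmorphN mulNr addrC.
  apply/fker; rewrite E; first by apply: JD => //; exact: JZ.
  by rewrite flin// !fx (alE nm) scaleNr addNr.
have [t tE] := Asub n0 _ zA; exists t; apply/eqP; rewrite -tofrac_eq; apply/eqP.
apply: (mulIf pi0).
have -> : (c n - e n m * c m)%:F * pi = (c n)%:F * pi - (e n m)%:F * ((c m)%:F * pi).
  by rewrite tofracB tofracM; ring.
have [_ <-] := cP n; have [_ <-] := cP m; rewrite (rBP nm).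
transitivity ((r n)%:F * (x n - (rB n m * e n m)%:F * x m)); first by rewrite !tofracM; ring.
by rewrite tE tofracM /pi; ring.
Qed.
End GermModule.

(** * Twisting units *)

Section Twist.
Context {d : Order.disp_t} {W : orderType d}.
Variables (K : fieldType) (S : W -> Prop).
Local Notation R := (gamma_ring K S).
Local Notation r := (@rX _ W K S).
Local Notation rB := (@rXB _ W K S).

Definition ubin (a : K) (t : W) : R := 1 + hterm (cuts S) a (eX t).

Lemma ubinE a t g : ubin a t g = (g == 0)%:R + (if g == eX t then a else 0).
Proof. by rewrite /ubin hahnDE hahn1E htermE// ltW// eX_gt0. Qed.

Lemma ubin_unit a t : ubin a t \is a GRing.unit.
Proof. by rewrite hahn_unitE ubinE eqxx lt_eqF ?eX_gt0// addr0 oner_eq0. Qed.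

Lemma ubin_sub_dvd a b n t : n <= t -> dvdR (r n) (ubin a t - ubin b t).
Proof.
move=> nt; apply/dvd_rX => g gn.
by rewrite hahnBE !ubinE (lt_eqF (lt_le_trans gn (eX_le nt))) subrr.
Qed.

Section Coherent.
Variable f : W -> W -> K.
Hypothesis fcoh : forall n m, n <= m -> finite_set [set t | t < n /\ f n t <> f m t].

(* The quotient of the formal infinite products of the [ubin (f n t) t] and the
   [ubin (f m t) t] over [t < n], which only differ in finitely many factors. *)
Definition twist (n m : W) : R :=
  \big[*%R/1]_(t \in [set` [pred t | t < n]]) (ubin (f n t) t / ubin (f m t) t).

Definition diffs_in (n m : W) (s : seq W) := forall t, t < n -> f n t != f m t -> t \in s.

Lemma diffs_ex n m : n <= m -> exists s, diffs_in n m s.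
Proof.
move=> /fcoh/finite_seqP[s sE]; exists s => t tn ne.
have : [set t | t < n /\ f n t <> f m t] t by split=> //; exact/eqP.
by rewrite sE.
Qed.

Lemma twist_seq n m s : uniq s -> diffs_in n m s ->
  twist n m = \prod_(t <- s | t < n) (ubin (f n t) t / ubin (f m t) t).
Proof.
move=> us sP; apply/esym/bigfs => // t tn ts.
have [->|ne] := eqVneq (f n t) (f m t); first exact/divrr/ubin_unit.
by rewrite sP in ts.
Qed.

Lemma twist_unit n m : twist n m \is a GRing.unit.
Proof.
rewrite /twist; apply: (big_ind (fun x : R => x \is a GRing.unit)) => [|x y xu yu|t _].
- exact: unitr1.
- by rewrite unitrM xu.
- by rewrite unitrM unitrV !ubin_unit.
Qed.

(** On a list containing all indices where the functions differ, the factors with [t < n] telescope.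
    The remaining factors of [twist m p] have [n <= t] and are congruent to [1] modulo [r n]. *)
Lemma twist_cocycle n m p : n <= m -> m <= p ->
  dvdR (r n) (twist n p - twist n m * twist m p).
Proof.
move=> nm mp; have [s1 P1] := diffs_ex nm; have [s2 P2] := diffs_ex mp.
have [s3 P3] := diffs_ex (le_trans nm mp).
set s := undup (s1 ++ s2 ++ s3); have us : uniq s by exact: undup_uniq.
rewrite (@twist_seq n p s)// => [|t tn /(P3 t tn) ts]; last first.
  by rewrite mem_undup !mem_cat ts !orbT.
rewrite (@twist_seq n m s)// => [|t tn /(P1 t tn) ts]; last by rewrite mem_undup !mem_cat ts.
rewrite (@twist_seq m p s)// => [|t tn /(P2 t tn) ts]; last first.
  by rewrite mem_undup !mem_cat ts orbT.
rewrite [X in _ * X](bigID (fun t => t < n)) /= mulrA.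
have E : \prod_(t <- s | (t < m) && (t < n)) (ubin (f m t) t / ubin (f p t) t) =
    \prod_(t <- s | t < n) (ubin (f m t) t / ubin (f p t) t).
  by apply: eq_bigl => t; case: (ltP t n) => tn; rewrite ?andbF// (lt_le_trans tn nm).
rewrite E -big_split /=.
under [X in _ - X * _]eq_bigr => t _ do rewrite mulrA divrK ?ubin_unit//.
rewrite -{1}[\prod_(t <- s | t < n) _]mulr1 -mulrBr; apply: dvdRMl.
rewrite -opprB -mulN1r; apply: dvdRMl.
apply: (big_ind (fun x : R => dvdR (r n) (x - 1))) => [|x y xn yn|t /andP[_ tn]].
- by rewrite subrr; exact: dvdR0.
- have -> : x * y - 1 = y * (x - 1) + (y - 1) by ring.
  by apply: dvdRD => //; exact: dvdRMl.
rewrite -leNgt in tn; rewrite -(divrr (ubin_unit (f p t) t)) -mulrBl mulrC.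
by apply: dvdRMl; exact: ubin_sub_dvd.
Qed.
End Coherent.

(* Below [eX t], the only exponent involving indices [>= t] is [eX t] itself: on such
   elements the coefficient at [eX t] is a derivation over the residue map. *)
Definition linear_at (t : W) (x : R) : Prop :=
  forall g, x g != 0 -> g <= eX t -> g = eX t \/ forall s, t <= s -> g s = 0.

Lemma linear_at_mul t x y : linear_at t x -> linear_at t y -> linear_at t (x * y).
Proof.
move=> lx ly g; rewrite hahnME => /hmul_neq0[a xa ya] gt.
have a0 := hahn_ge0 xa; have b0 := hahn_ge0 ya.
have at_ : a <= eX t by apply: le_trans gt; rewrite -[X in _ <= X](subrK a) addrC -{1}[a]addr0 leD2l.
have bt : g - a <= eX t by apply: le_trans gt; rewrite leBl_ge0.
have [aE|al] := lx a xa at_.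
  left; apply/eqP; rewrite eq_le gt -aE /=.
  by rewrite -[X in _ <= X](subrK a) addrC -{1}[a]addr0 leD2l.
have [bE|bl] := ly _ ya bt.
  left; apply/eqP; rewrite eq_le gt -bE /=; by rewrite leBl_ge0.
by right=> s ts; rewrite -(subrK a g) expoDE al// bl// addr0.
Qed.

Lemma linear_at_coef t x y : linear_at t x -> linear_at t y ->
  (x * y) (eX t) = x 0 * y (eX t) + x (eX t) * y 0.
Proof.
move=> lx ly; have t0 := eX_gt0 t.
rewrite hahnME (@hmul_seqE _ _ _ _ _ _ [:: 0; eX t]) => [||a xa ya].
- by rewrite big_cons big_seq1 subr0 subrr.
- by rewrite /= inE lt_eqF.
rewrite !inE; apply/orP; have a0 := hahn_ge0 xa; have b0 := hahn_ge0 ya.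
have [|->|al] := lx a xa; [by rewrite -leBr0|by right; rewrite eqxx|].
have [|E|bl] := ly _ ya; first by rewrite leBl_ge0.
  by left; rewrite -(subKr (eX t) a) E subrr.
have := eXE t t; rewrite eqxx -(subrK a (eX t)) expoDE al// bl//.
Qed.

Lemma linear_at_ubin t a s : linear_at t (ubin a s).
Proof.
move=> g; rewrite ubinE; have [-> _ _|g0] := eqVneq g 0; first by right=> u _; rewrite expo0E.
case: (g =P eX s) => [->|]; last by rewrite addr0 eqxx.
rewrite add0r => _; have [st _|ts|->] := ltgtP s t; last by left.
  by right=> u tu; rewrite eXE gt_eqF// (lt_le_trans st).
by rewrite leNgt eX_lt.
Qed.

Lemma ubin0 a s : ubin a s 0 = 1.
Proof. by rewrite ubinE eqxx lt_eqF ?eX_gt0// addr0. Qed.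

Lemma linear_at_prod t (a : W -> K) (P : pred W) s : uniq s ->
  let x := \prod_(u <- s | P u) ubin (a u) u in
  [/\ linear_at t x, x 0 = 1 & x (eX t) = if (t \in s) && P t then a t else 0].
Proof.
elim: s => [_|u s IH /= /andP[us /IH[lx x0 xt]]] /=; rewrite ?big_nil ?big_cons.
  split; last by rewrite hahn1E gt_eqF ?eX_gt0.
    move=> g; rewrite hahn1E; case: (g =P 0) => [->|]; rewrite ?eqxx//.
    by right=> s _; rewrite expo0E.
  by rewrite hahn1E eqxx.
case: ifP => Pu.
  split; first by apply: linear_at_mul => //; exact: linear_at_ubin.
    by rewrite hahnM0 ubin0 x0 mulr1.
  rewrite linear_at_coef//; last exact: linear_at_ubin.
  rewrite ubin0 mul1r xt x0 mulr1 ubinE gt_eqF ?eX_gt0// add0r inE (inj_eq (@eX_inj _ W)).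
  case: (t =P u) => [->|_]; last by rewrite addr0.
  by rewrite (negPf us) /= Pu add0r.
split=> //; rewrite xt inE; case: (t =P u) => [->|//].
by rewrite Pu !andbF.
Qed.

Section Contradiction.
Variable f : W -> W -> K.
Hypothesis fcoh : forall n m, n <= m -> finite_set [set t | t < n /\ f n t <> f m t].

(** After clearing denominators, compare coefficients modulo [r n]. At [0] they give [c 0 = c' 0];
    at [eX t], where [c] and [c'] vanish, they give [f m t * c 0 = f n t * c' 0] for each listed
    [t]. *)
Lemma twist_coef n m t a (c c' : R) : n <= m -> c \is a GRing.unit ->
  dvdR (r n) (c - twist f n m * c') ->
  (forall g, c g != 0 -> eqout (Some n) g 0 -> eqabove a g 0) ->
  (forall g, c' g != 0 -> eqout (Some n) g 0 -> eqabove a g 0) ->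
  a < t -> t < n -> f n t = f m t.
Proof.
move=> nm cu cc' cP c'P aT tn; have [s0 sP0] := diffs_ex fcoh nm.
set s := undup s0; have us : uniq s by exact: undup_uniq.
have sP : diffs_in f n m s by move=> u un ne; rewrite mem_undup sP0.
(* An exponent of [x] up to [eX t] has no variables from [n] on, so by the bound it has none above
   [a], in particular none from [t] on. *)
have lin (x : R) : (forall g, x g != 0 -> eqout (Some n) g 0 -> eqabove a g 0) ->
    linear_at t x /\ x (eX t) = 0.
  move=> xP; split=> [g xg gt|].
    right=> u tu; rewrite (xP g xg) ?expo0E ?(lt_le_trans aT)// => v vn.
    rewrite expo0E (expo_small_above (hahn_ge0 xg) gt)//.
    by apply: lt_le_trans tn _; rewrite leNgt.
  apply/eqP/negPn/negP => /xP/(_ _ t aT).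
  rewrite eXE eqxx expo0E => /(_ _)/eqP F; have : false; last by [].
  apply: F => v vn; rewrite eXE expo0E; case: (v =P t) => // vt.
  by rewrite vt /= tn in vn.
have [lc ct] := lin c cP; have [lc' ct'] := lin c' c'P.
have [lx x0 xt] := linear_at_prod t (f n) (fun u => u < n) us.
have [ly y0 yt] := linear_at_prod t (f m) (fun u => u < n) us.
set x := \prod_(u <- s | u < n) ubin (f n u) u in lx x0 xt.
set y := \prod_(u <- s | u < n) ubin (f m u) u in ly y0 yt.
have yu : y \is a GRing.unit by rewrite hahn_unitE y0 oner_eq0.
have E : twist f n m = x / y.
  by rewrite (twist_seq us sP) big_split /= prodrV// => u _; exact: ubin_unit.
have : dvdR (r n) (y * c - x * c').
  have -> : y * c - x * c' = y * (c - twist f n m * c').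
    by rewrite E mulrBr [_ / _]mulrC !mulrA divrr// mul1r.
  exact: dvdRMl.
move=> /dvd_rX H; have := H (eX t) (eX_lt tn); have := H 0 (eX_gt0 n).
rewrite !hahnBE !hahnM0 !linear_at_coef// x0 y0 ct ct' !mul1r !add0r.
move=> /eqP; rewrite subr_eq0 => /eqP <-; rewrite -mulrBl => /eqP.
rewrite mulf_eq0; move: cu; rewrite hahn_unitE => /negPf->; rewrite orbF subr_eq0 xt yt tn andbT.
case: ifPn => [_ /eqP//|ts _]; apply: contrapT => /eqP ne.
by rewrite sP in ts.
Qed.
End Contradiction.
End Twist.

(** * Non-standardness *)

Section Main.
Context {d : Order.disp_t} {W : orderType d}.
Let lt := fun x y : W => is_true (x < y).
Hypothesis HW : is_omega1 lt.

Lemma omega1_bounded_seq (u : nat -> W) : exists b, forall n, u n < b.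
Proof.
have cu : countable (range u).
  exact: (sub_countable (card_image_le _ _) (countableP _)).
have [b bP] := omega1_bounded HW cu.
by exists b => n; apply: bP; exists n.
Qed.

Lemma iter_inj (s : W -> W) x : (forall y, y < s y) -> injective (fun k => iter k s x).
Proof.
move=> sP; have ulei i j : (i < j)%N -> iter i s x < iter j s x.
  elim: j => // j IH; rewrite ltnS leq_eqVlt => /orP[/eqP->|/IH ij]; first exact: sP.
  exact: lt_trans ij (sP _).
move=> i j /= uij; have [ij|ji|//] := ltngtP i j.
  by have := ulei _ _ ij; rewrite uij ltxx.
by have := ulei _ _ ji; rewrite uij ltxx.
Qed.

(** Uniformity glues the functions [rho _ D] to one function above [a] with values in [nat]. It has
    an unbounded fibre, and infinitely many points of that fibre lie below a single [D] in [T]. *)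
Lemma finite_to_one_not_uniform (rho : W -> W -> nat) (a : W) (T : W -> Prop) :
  (forall b n, finite_set [set x | x < b /\ (rho x b <= n)%N]) ->
  (forall b, exists2 D, T D & b < D) ->
  ~ (forall D E t, T D -> T E -> D <= E -> a < t -> t < D -> rho t D = rho t E).
Proof.
move=> fin Tunb unif.
have /choice[nu nuP] : forall t, exists D, T D /\ t < D.
  by move=> t; have [D TD tD] := Tunb t; exists D.
have unif2 t D : a < t -> T D -> t < D -> rho t (nu t) = rho t D.
  move=> at_ TD tD; have [Tn tn] := nuP t.
  have [/unif->//|/ltW/unif->//] := leP (nu t) D.
pose B n := [set t | a < t /\ rho t (nu t) = n].
have [n Bunb] : exists n, forall b, exists2 t, B n t & b < t.
  apply: contrapT => no.
  have /choice[b bP] : forall n, exists b, forall t, B n t -> t <= b.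
    move=> n; apply: contrapT => nb; apply: no; exists n => b; apply: contrapT => nt.
    apply: nb; exists b => t Bt; rewrite leNgt; apply/negP => bt; apply: nt.
    by exists t.
  (* If all fibres were bounded, a point [c] above all bounds would still lie in a fibre; [a] is
     prepended to the bounds so that [a < c]. *)
  have [c cP] := omega1_bounded_seq (fun n => if n is m.+1 then b m else a).
  have ac : a < c := cP 0%N.
  have := bP _ c (conj ac erefl); rewrite leNgt => /negP; apply.
  exact: (cP (rho c (nu c)).+1).
have /choice[s sP] : forall b, exists t, B n t /\ b < t.
  by move=> b; have [t Bt bt] := Bunb b; exists t.
pose u k := iter k s (s a).
have uB k : B n (u k) by case: k => [|k]; [case: (sP a)|case: (sP (u k))].
have uinj : injective u by apply: iter_inj => x; case: (sP x).
have [b bP] := omega1_bounded_seq u; have [D TD bD] := Tunb b.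
apply: infinite_nat; apply: (@sub_finite_set _ _ (u @^-1` [set x | x < D /\ (rho x D <= n)%N])).
  move=> k _ /=; have [auk ruk] := uB k; have ukD := lt_trans (bP k) bD.
  by rewrite -(unif2 _ D auk TD ukD) ruk.
by apply: finite_preimage (fin D n) => i j _ _ /uinj.
Qed.


Variables (K : fieldType) (S : W -> Prop).
Hypotheses (CH : equipotent (nat -> bool) W) (HK : equipotent K W) (HS : stationary lt S).
Local Notation R := (gamma_ring K S).
Local Notation r := (@rX _ W K S).
Local Notation rB := (@rXB _ W K S).

(** Tameness of [c D] at the cut [D] in [S] provides a bound [h D < D] for its coefficient at [0].
    Pressing down makes this bound constant on an unbounded set, where comparing coefficients forces
    the values of [rho] to agree. *)
Lemma coherent_twist_nontrivial (rho : W -> W -> nat) (iota : nat -> K) (c : W -> R) :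
  injective iota ->
  (forall b n, finite_set [set x | x < b /\ (rho x b <= n)%N]) ->
  (forall n m, n <= m -> finite_set [set t | t < n /\ iota (rho t n) <> iota (rho t m)]) ->
  (forall n, c n \is a GRing.unit) ->
  ~ forall n m, n <= m ->
      dvdR (r n) (c n - twist S (fun n t => iota (rho t n)) n m * c m).
Proof.
move=> iinj fin coh cU ccoh.
have /choice[h hP] : forall D, exists u, S D -> is_limit lt D -> u < D /\
    forall g, c D g != 0 -> eqout (Some D) g 0 -> eqabove u g 0.
  move=> D; have [[SD DL]|no] := pselect (S D /\ is_limit lt D); last first.
    by exists D => SD DL; case: no.
  have [[m mD] _] := DL.
  by have [u uD uP] := gamma_tame (c D) (conj SD DL : cuts S (Some D)) mD 0; exists u.
have [D SD DL|a aP] := pressing_down HW HS (h := h); first by case: (hP D SD DL).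
pose T D := [/\ S D, is_limit lt D & h D = a].
apply: (@finite_to_one_not_uniform rho a T fin).
  by move=> b; have [D [bD SD DL hD]] := aP b; exists D.
move=> D E t [SD DL hD] [SE EL hE] DE at_ tD; apply: iinj.
apply: (twist_coef (f := fun n t => iota (rho t n)) coh DE (cU D) (ccoh D E DE) _ _ at_ tD).
  by have [_] := hP D SD DL; rewrite hD.
have [_] := hP E SE EL; rewrite hE => EP g cg gD; apply: EP => // v vE; apply: gD.
by apply: contra vE => vD; exact: lt_le_trans vD DE.
Qed.

Lemma gamma_nonstandard :
  exists M : lmodType R, nonstandard_uniserial M /\ has_type_QR M.
Proof.
have [rho [fin coh]] := coherent_finite_to_one HW.
(* A sequence of distinct elements of [K] suffices to encode the values of [rho]. *)
have [iota iinj] : exists iota : nat -> K, injective iota.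
  have [k [k' kk' k'k]] := HK.
  have /choice[s sP] := omega1_succ HW.
  exists (fun n => k' (iter n s (k 0))) => i j /(can_inj k'k).
  exact: iter_inj.
pose f n t := iota (rho t n).
have fcoh n m : n <= m -> finite_set [set t | t < n /\ f n t <> f m t].
  rewrite le_eqVlt => /orP[/eqP->|nm].
    by apply: sub_finite_set (@finite_set0 _) => t [_].
  by apply: sub_finite_set (coh n m nm) => t [tn ne]; split=> //; rewrite /f in ne *;
    move=> E; apply: ne; rewrite E.
have vR : valuation_domain R := @hahn_valuation _ _ _ _.
have r0 n : r n != 0 := rX_neq0 _ _ n.
have rN1 n : ~ dvdR (r n) 1.
  by move=> /dvd_rX/(_ 0 (eX_gt0 n)) /eqP; rewrite hahn1E eqxx oner_eq0.
have rcof (x : R) : x != 0 -> exists n, dvdR x (r n) := @dvd_rX_ex _ _ HW _ _ x.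
have rBP m n (mn : m <= n) : r n = rB m n * r m := rX_rXB _ _ mn.
have eU n m := twist_unit S f n m.
have ecoh n m p := @twist_cocycle _ _ K S f fcoh n m p.
have [M [al [alE al0 algen]]] := germ_module r0 rBP rcof eU ecoh.
exists M; split; last exact (germ_type r0 rBP rN1 rcof alE al0).
split; first exact (germ_uniserial vR alE algen).
move=> stdM; have [c [cU ccoh]] := standard_units vR r0 rBP rN1 rcof alE al0 stdM.
exact: coherent_twist_nontrivial iinj fin fcoh cU ccoh.
Qed.

Lemma gamma_theorem :
  exists R : idomainType,
    [/\ valuation_domain R,
        equipotent R W,
        residue_field_is R K
      & exists r : W -> R,
          [/\ (forall n, r n != 0),
              (forall m n, lt m n -> dvdR (r m) (r n)),
              (forall q : {fraction R}, exists n, inR ((r n)%:F * q)),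
              club_equiv lt (GammaQR_set lt r) S
            & exists M : lmodType R,
                nonstandard_uniserial M /\ has_type_QR M]].
Proof.
exists R; split.
- exact: hahn_valuation.
- by apply: gamma_card.
- exact: hahn_residue.
exists r; split.
- exact: rX_neq0.
- exact: rX_dvd.
- by apply: rX_cofinal.
- by apply: gamma_equiv.
- exact: gamma_nonstandard.
Qed.
End Main.

(** * Orders of type omega_1 as ordered types *)

Section OrderOfOmega1.
Variables (W : Type) (lt : W -> W -> Prop) (HW : is_omega1 lt).

(** The alias mentions the proof [HW] so that order instances depending on it can be attached. *)
Definition omega1 (_ : is_omega1 lt) : Type := W.
Local Notation T := (omega1 HW).

HB.instance Definition _ := gen_eqMixin T.
HB.instance Definition _ := gen_choiceMixin T.

Definition omega1_lt (x y : T) : bool := `[< lt x y >].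
Fact omega1_ltxx : irreflexive omega1_lt.
Proof. by move=> x; apply/asboolP; case: HW => H _; exact: H. Qed.
Fact omega1_lt_trans : transitive omega1_lt.
Proof.
by move=> y x z /asboolP xy /asboolP yz; apply/asboolP; case: HW => _ [H _]; exact: H xy yz.
Qed.
HB.instance Definition _ := Order.Lt_isPOrder.Build (Order.Disp tt tt) T omega1_ltxx omega1_lt_trans.
Fact omega1_total : total (<=%O : rel T).
Proof.
move=> x y; have [_ [_ [/(_ x y) H _]]] := HW.
case: H => [xy|[->|yx]]; first by rewrite ltW//; exact/asboolP.
  by rewrite lexx.
by rewrite [X in _ || X]ltW ?orbT//; exact/asboolP.
Qed.
HB.instance Definition _ := Order.POrder_isTotal.Build (Order.Disp tt tt) T omega1_total.

Lemma omega1_ltE : lt = (fun x y : T => is_true (x < y)).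
Proof. by apply/funext => x; apply/funext => y; apply/propext; split=> [xy|/asboolP//]; exact/asboolP. Qed.
End OrderOfOmega1.

Theorem theorem11
  (W : Type) (lt : W -> W -> Prop) (HW : is_omega1 lt)
  (CH : equipotent (nat -> bool) W)
  (K : fieldType) (HK : equipotent K W)
  (S : W -> Prop) (HS : stationary lt S) :
  exists R : idomainType,
    [/\ valuation_domain R,
        equipotent R W,
        residue_field_is R K
      & exists r : W -> R,
          [/\ (forall n, r n != 0),
              (forall m n, lt m n -> dvdR (r m) (r n)),
              (forall q : {fraction R}, exists n, inR ((r n)%:F * q)),
              club_equiv lt (GammaQR_set lt r) S
            & exists M : lmodType R,
                nonstandard_uniserial M /\ has_type_QR M]].
Proof.
have HW' := HW; rewrite [X in is_omega1 X](omega1_ltE HW) in HW'.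
rewrite (omega1_ltE HW) in HS *.
exact (@gamma_theorem _ (omega1 HW) HW' K S CH HK HS).
Qed.
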